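(* Let $X$ and $Y$ be cellular spaces with $X$ compact, and let $r\ge 0$ be an integer. Then the relation $\overset{r}{\sim}$ of $r$-similarity on the set $Y^X$ of based continuous maps $X\to Y$ is an equivalence relation.
   Context: All spaces are based topological spaces with basepoint denoted $*$. A cellular space is a CW-complex whose basepoint is a vertex. A subspace of a space is a subset containing the basepoint. Maps are based continuous maps; $Y^X$ is the set of maps $X\to Y$; $\sim$ denotes based homotopy of maps. For a set $E$, $\langle E\rangle$ is the free abelian group with basis elements $\langle e\rangle$, $e\in E$. Elements of $\langle Y^X\rangle$ are called ensembles; an ensemble is a finite sum $A=\sum_i u_i\langle a_i\rangle$ with $u_i\in\mathbb Z$, $a_i\in Y^X$ (the $a_i$ need not be distinct). For a subspace $Z\subseteq X$, restriction of maps induces a homomorphism $\langle Y^X\rangle\to\langle Y^Z\rangle$, $A\mapsto A|_Z$. $\mathcal F_r(X)$ is the set of subspaces $T\subseteq X$ containing at most $r$ points distinct from the basepoint. For $A,B\in\langle Y^X\rangle$, $A\overset{r}{=}B$ means that $A|_T=B|_T$ in $\langle Y^T\rangle$ for all $T\in\mathcal F_r(X)$. For $a,b\in Y^X$, $a$ is $r$-similar to $b$, written $a\overset{r}{\sim}b$, if there is an ensemble $A=\sum_i u_i\langle a_i\rangle\in\langle Y^X\rangle$ with all $a_i\sim a$ such that $A\overset{r}{=}\langle b\rangle$. *)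

(* Defs.v *)
From HB Require Import structures.
From mathcomp Require Import all_boot all_order all_algebra.
From mathcomp Require Import all_classical all_reals all_analysis.
From mathcomp Require Import freeg.

Set Implicit Arguments.
Unset Strict Implicit.
Unset Printing Implicit Defensive.

Import Order.TTheory GRing.Theory Num.Theory.
Import numFieldNormedType.Exports.

Local Open Scope classical_set_scope.
Local Open Scope ring_scope.

(* The norm that the library puts on ['rV[R]_n] is the sup norm, hence the
   explicit Euclidean discs. For n = 0 both discs are the point and the sphere
   is empty. *)
Definition sqnorm (R : realType) (n : nat) (v : 'rV[R]_n) : R :=
  \sum_(i < n) v ord0 i ^+ 2.

Definition closed_disc (R : realType) (n : nat) : set 'rV[R]_n :=
  [set v | sqnorm v <= 1].

Definition open_disc (R : realType) (n : nat) : set 'rV[R]_n :=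
  [set v | sqnorm v < 1].

Definition unit_sphere (R : realType) (n : nat) : set 'rV[R]_n :=
  [set v | sqnorm v = 1].

Arguments closed_disc : clear implicits.
Arguments open_disc : clear implicits.
Arguments unit_sphere : clear implicits.

(* A characteristic map is a total function on ['rV[R]_n], of which only the
   values on the closed disc matter. *)
Record cw_structure (R : realType) (X : topologicalType) := CWStructure {
  cell : Type;
  cell_dim : cell -> nat;
  char_map : forall e : cell, 'rV[R]_(cell_dim e) -> X;
  cw_hausdorff : hausdorff_space X;
  char_map_continuous : forall e : cell,
    {within closed_disc R (cell_dim e), continuous (@char_map e)};
  char_map_inj : forall e : cell,
    set_inj (open_disc R (cell_dim e)) (@char_map e);
  (* with [char_map_continuous] and [char_map_inj]: [char_map e] is a
     homeomorphism from the open disc onto the open cell *)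
  char_map_open : forall (e : cell) (U : set 'rV[R]_(cell_dim e)), open U ->
    exists2 V : set X, open V &
      @char_map e @` (open_disc R (cell_dim e) `&` U) =
      @char_map e @` open_disc R (cell_dim e) `&` V;
  cells_disjoint :
    trivIset [set: cell] (fun e => @char_map e @` open_disc R (cell_dim e));
  cells_cover :
    \bigcup_(e in [set: cell]) (@char_map e @` open_disc R (cell_dim e)) = setT;
  closure_finite : forall e : cell, exists F : set cell,
    [/\ finite_set F,
        forall c, F c -> (cell_dim c < cell_dim e)%N &
        @char_map e @` unit_sphere R (cell_dim e) `<=`
          \bigcup_(c in F) (@char_map c @` open_disc R (cell_dim c))];
  weak_closed : forall A : set X,
    (forall e : cell, closed (A `&` @char_map e @` closed_disc R (cell_dim e))) ->
    closed A
}.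

Arguments char_map {R X} c e _ : rename.

(* Based spaces are the library's pointed topological spaces. *)
Definition cellular (R : realType) (X : ptopologicalType) : Prop :=
  exists (K : cw_structure R X) (e : cell K),
    cell_dim e = 0%N /\
    (char_map K e @` open_disc R (cell_dim e)) point.

HB.mixin Record isBased (X Y : ptopologicalType) (f : X -> Y) := {
  based_point : f point = point
}.

#[short(type = "basedMap")]
HB.structure Definition BasedMap (X Y : ptopologicalType) :=
  {f of isBased X Y f & isContinuous X Y f}.

HB.instance Definition _ (X Y : ptopologicalType) :=
  gen_eqMixin (basedMap X Y).
HB.instance Definition _ (X Y : ptopologicalType) :=
  gen_choiceMixin (basedMap X Y).

Record basedSubset (X : ptopologicalType) := BasedSubset {
  based_set :> set X;
  based_set_point : based_set point
}.

Definition basedSub (X : ptopologicalType) (T : basedSubset X) : Type :=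
  set_type (based_set T).

HB.instance Definition _ (X : ptopologicalType) (T : basedSubset X) :=
  Topological.copy (basedSub T) (set_type (based_set T)).
HB.instance Definition _ (X : ptopologicalType) (T : basedSubset X) :=
  isPointed.Build (basedSub T) (exist _ point (mem_set (based_set_point T))).

Definition incl (X : ptopologicalType) (T : basedSubset X) :
  basedSub T -> X := set_val.

Fact incl_continuous (X : ptopologicalType) (T : basedSubset X) :
  continuous (@incl X T).
Proof. exact: initial_continuous. Qed.

Fact incl_point (X : ptopologicalType) (T : basedSubset X) :
  @incl X T point = point.
Proof. by []. Qed.

HB.instance Definition _ (X : ptopologicalType) (T : basedSubset X) :=
  isContinuous.Build (basedSub T) X (@incl X T) (@incl_continuous X T).
HB.instance Definition _ (X : ptopologicalType) (T : basedSubset X) :=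
  isBased.Build (basedSub T) X (@incl X T) (@incl_point X T).

Section based_comp.
Context (X Y Z : ptopologicalType) (f : basedMap X Y) (g : basedMap Y Z).

Fact comp_point : (g \o f) point = point.
Proof. by rewrite /= !based_point. Qed.

HB.instance Definition _ := isBased.Build X Z (g \o f) comp_point.
End based_comp.

Definition restrict_map (X Y : ptopologicalType) (T : basedSubset X)
  (a : basedMap X Y) : basedMap (basedSub T) Y := a \o @incl X T.

Definition homotopic (R : realType) (X Y : ptopologicalType)
    (a b : basedMap X Y) : Prop :=
  exists H : R * X -> Y,
    [/\ {within `[0, 1] `*` [set: X], continuous H},
        forall x, H (0, x) = a x,
        forall x, H (1, x) = b x &
        forall t, `[0, 1]%classic t -> H (t, point) = point].

Definition ensemble (X Y : ptopologicalType) : Type := {freeg (basedMap X Y)}.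

Definition restrict (X Y : ptopologicalType) (T : basedSubset X)
    (A : ensemble X Y) : ensemble (basedSub T) Y :=
  fglift (fun a : basedMap X Y => << restrict_map T a >>) A.

Definition Fr (r : nat) (X : ptopologicalType) : set (basedSubset X) :=
  [set T | (T `\ point #<= `I_r)%card].

Definition r_equal (r : nat) (X Y : ptopologicalType)
    (A B : ensemble X Y) : Prop :=
  forall T : basedSubset X, Fr r T -> restrict T A = restrict T B.

Definition r_similar (R : realType) (r : nat) (X Y : ptopologicalType)
    (a b : basedMap X Y) : Prop :=
  exists (n : nat) (u : 'I_n -> int) (c : 'I_n -> basedMap X Y),
    (forall i, homotopic R (c i) a) /\
    r_equal r (\sum_(i < n) << u i *g c i >>) << b >>.

(* Main.v *)
(* Let A be an ensemble of maps homotopic to a, r-equal to b.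

   Any finite number of maps X -> Y takes values in a finite subcomplex S of Y.
   By induction on the cells of S, the second projection S x S -> S is homotopic
   to a map that near the diagonal depends on the first argument only. Applied
   pointwise, deformations of this kind preserve coincidences of maps, hence
   r-equality. They show that r-similarity to b only depends on the homotopy
   class of b, which gives transitivity, and they allow to assume that A and b
   agree on neighbourhoods of any r points.

   For symmetry, one builds for every c homotopic to a, and by induction on s,
   an ensemble of maps homotopic to b that is s-equal to c and consists of maps
   equal to c near r - s prescribed points. Maps of A that agree with b near
   these points are moved to c along a homotopy, one small piece of X at a time;
   on each piece the induction hypothesis, with the piece added to the
   prescribed set, provides maps homotopic to b that can be moved likewise. Near
   the prescribed set the homotopies are loops at c, and the result is not c but
   a combination of c twisted by these loops along a collar. The combination has
   total coefficient 1, and since s points miss one of s + 1 disjoint collars,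
   it can be inverted as a unipotent element. *)

Require Import Defs.
From HB Require Import structures.
From mathcomp Require Import all_boot all_order all_algebra.
From mathcomp Require Import all_classical all_reals all_analysis.
From mathcomp Require finmap.
From mathcomp Require Import freeg.
From mathcomp Require Import lra.

Set Implicit Arguments.
Unset Strict Implicit.
Unset Printing Implicit Defensive.

Import Order.TTheory GRing.Theory Num.Theory.
Import numFieldNormedType.Exports.

Local Open Scope classical_set_scope.
Local Open Scope ring_scope.

(** * Continuity relative to a subset *)

Definition cont_in (T U : topologicalType) (D : set T) (f : T -> U) :=
  forall x, D x -> f @ within D (nbhs x) --> f x.

(** Relative closedness is phrased with neighbourhoods in [D], like [cont_in], so that [A] need not
    be a subset of [D] and no subspace type appears. *)
Definition closed_in (T : topologicalType) (D A : set T) :=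
  forall x, D x -> ~ A x -> \forall y \near within D (nbhs x), ~ A y.

Section cont_in.
Variables T U V : topologicalType.
Implicit Types (D E : set T).

Lemma cont_inP D (f : T -> U) : {within D, continuous f} <-> cont_in D f.
Proof. exact: subspace_continuousP. Qed.

Lemma cont_inT (f : T -> U) : cont_in setT f <-> continuous f.
Proof.
split=> cf x; first by have := cf x I; rewrite withinET.
by move=> _; rewrite withinET; exact: cf.
Qed.

Lemma continuous_in D (f : T -> U) : continuous f -> cont_in D f.
Proof.
move=> cf x _; apply: cvg_trans (cf x).
by apply: cvg_app; exact: cvg_within.
Qed.

Lemma cont_in_sub D E (f : T -> U) : D `<=` E -> cont_in E f -> cont_in D f.
Proof.
move=> DE cf x Dx P /(cf _ (DE _ Dx)) /=; rewrite !nbhs_simpl/= /within/=.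
by apply: filterS => y + /DE; apply.
Qed.

Lemma cont_in_eq D (f g : T -> U) :
  (forall x, D x -> f x = g x) -> cont_in D f -> cont_in D g.
Proof.
move=> fg cf x Dx; rewrite -fg//; apply: cvg_trans (cf x Dx).
apply: near_eq_cvg; rewrite near_withinE; apply: nearW => y; exact: fg.
Qed.

Lemma cont_in_comp (D : set U) E (g : U -> V) (f : T -> U) :
  cont_in D g -> cont_in E f -> (forall x, E x -> D (f x)) ->
  cont_in E (g \o f).
Proof.
move=> cg cf ED x Ex P /(cg _ (ED _ Ex)) /= Q.
have /(cf x Ex) := Q; rewrite /= !nbhs_simpl/= /within/=.
by apply: filterS => y + Ey => /(_ Ey); apply; exact: ED.
Qed.

Lemma cont_in_pair E (f : T -> U) (g : T -> V) :
  cont_in E f -> cont_in E g -> cont_in E (fun x => (f x, g x)).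
Proof. by move=> cf cg x Ex; apply: cvg_pair; [exact: cf|exact: cg]. Qed.

(** Each piece is treated separately at a point [x]: either [x] lies in it and continuity on it
    applies, or relative closedness gives a neighbourhood of [x] that misses it. *)
Lemma glue_in D (A B : set T) (f : T -> U) : D `<=` A `|` B ->
  closed_in D A -> closed_in D B ->
  cont_in (D `&` A) f -> cont_in (D `&` B) f -> cont_in D f.
Proof.
move=> DAB cA cB fA fB x Dx W Wfx /=.
have key (C : set T) : closed_in D C -> cont_in (D `&` C) f ->
    \forall y \near within D (nbhs x), C y -> W (f y).
  move=> cC fC; have [Cx|nCx] := pselect (C x).
    have H : nbhs x [set y | (D `&` C) y -> W (f y)] by exact: fC.
    suff : nbhs x [set y | D y -> C y -> W (f y)] by [].
    by apply: filterS H => y H Dy Cy; exact: H.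
  suff : nbhs x [set y | D y -> C y -> W (f y)] by [].
  have H : nbhs x [set y | D y -> ~ C y] by exact: cC.
  by apply: filterS H => y H Dy Cy; case: (H Dy).
suff : nbhs x [set y | D y -> W (f y)] by [].
have HA : nbhs x [set y | D y -> A y -> W (f y)] by exact: key.
have HB : nbhs x [set y | D y -> B y -> W (f y)] by exact: key.
apply: filterS2 HA HB => y /= HA HB Dy.
by have [Ay|By] := DAB y Dy; [exact: (HA Dy Ay)|exact: (HB Dy By)].
Qed.

Lemma closed_closed_in D (A : set T) : closed A -> closed_in D A.
Proof.
move=> cA x Dx nAx; have : nbhs x (~` A).
  by apply: open_nbhs_nbhs; split => //; exact: closed_openC.
by rewrite /within/=; apply: filterS.
Qed.

Lemma closed_inI D (A B : set T) : closed_in D A -> closed_in D B ->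
  closed_in D (A `&` B).
Proof.
move=> cA cB x Dx /not_andP[nAx|nBx].
  have H : nbhs x [set y | D y -> ~ A y] by exact: cA.
  suff : nbhs x [set y | D y -> ~ (A `&` B) y] by [].
  by apply: filterS H => y H /H nAy [].
have H : nbhs x [set y | D y -> ~ B y] by exact: cB.
suff : nbhs x [set y | D y -> ~ (A `&` B) y] by [].
by apply: filterS H => y H /H nBy [].
Qed.

End cont_in.

(** * Real-valued functions and cut-offs *)

Section real_cont_in.
Variables (R : realType) (T : topologicalType).
Implicit Types (D : set T) (f g : T -> R).

Lemma cont_in_cst (U : topologicalType) D (c : U) : cont_in D (fun _ : T => c).
Proof. by move=> x _; exact: cvg_cst. Qed.

Lemma cont_in_id D : cont_in D (fun x : T => x).
Proof. by apply: continuous_in => x; exact: cvg_id. Qed.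

Lemma cont_in_fst (U V : topologicalType) D (f : T -> U * V) :
  cont_in D f -> cont_in D (fun x => (f x).1).
Proof.
move=> cf; apply: (cont_in_comp (D := setT)) cf _ => //.
by apply: continuous_in => x; exact: cvg_fst.
Qed.

Lemma cont_in_snd (U V : topologicalType) D (f : T -> U * V) :
  cont_in D f -> cont_in D (fun x => (f x).2).
Proof.
move=> cf; apply: (cont_in_comp (D := setT)) cf _ => //.
by apply: continuous_in => x; exact: cvg_snd.
Qed.

Lemma cont_inD D f g :
  cont_in D f -> cont_in D g -> cont_in D (fun x => f x + g x).
Proof. by move=> cf cg x Dx; apply: cvgD; [exact: cf|exact: cg]. Qed.

Lemma cont_inN D f : cont_in D f -> cont_in D (fun x => - f x).
Proof. by move=> cf x Dx; apply: cvgN; exact: cf. Qed.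

Lemma cont_inB D f g :
  cont_in D f -> cont_in D g -> cont_in D (fun x => f x - g x).
Proof. by move=> cf cg; apply: cont_inD => //; exact: cont_inN. Qed.

Lemma cont_inM D f g :
  cont_in D f -> cont_in D g -> cont_in D (fun x => f x * g x).
Proof. by move=> cf cg x Dx; apply: cvgM; [exact: cf|exact: cg]. Qed.

Lemma cont_in_norm D f : cont_in D f -> cont_in D (fun x => `|f x|).
Proof. by move=> cf x Dx; apply: cvg_norm; exact: cf. Qed.

Lemma cont_inV D f : (forall x, D x -> f x != 0) -> cont_in D f ->
  cont_in D (fun x => (f x)^-1).
Proof. by move=> f0 cf x Dx; apply: cvgV; [exact: f0|exact: cf]. Qed.

Lemma cont_in_min D f g : cont_in D f -> cont_in D g ->
  cont_in D (fun x => Num.min (f x) (g x)).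
Proof.
move=> cf cg; apply: (cont_in_eq (f := fun x => (f x + g x - `|f x - g x|) / 2)).
  by move=> x _; rewrite minr_absE.
apply: cont_inM; last exact: cont_in_cst.
by apply: cont_inB; [exact: cont_inD|apply: cont_in_norm; exact: cont_inB].
Qed.

Lemma cont_in_max D f g : cont_in D f -> cont_in D g ->
  cont_in D (fun x => Num.max (f x) (g x)).
Proof.
move=> cf cg; apply: (cont_in_eq (f := fun x => (f x + g x + `|f x - g x|) / 2)).
  by move=> x _; rewrite maxr_absE.
apply: cont_inM; last exact: cont_in_cst.
by apply: cont_inD; [exact: cont_inD|apply: cont_in_norm; exact: cont_inB].
Qed.

(** Cut-off functions below are mostly [clamp] of an affine expression: where they are 0 or 1 is
    then a linear inequality, within reach of [lra]. *)
Definition clamp (x : R) : R := Num.max 0 (Num.min 1 x).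

Lemma cont_in_clamp D f : cont_in D f -> cont_in D (fun x => clamp (f x)).
Proof.
by move=> cf; apply: cont_in_max; [|apply: cont_in_min => //]; exact: cont_in_cst.
Qed.

Lemma clamp_ge0 x : 0 <= clamp x.
Proof. by rewrite /clamp le_max lexx. Qed.

Lemma clamp_le1 x : clamp x <= 1.
Proof. by rewrite /clamp ge_max ler01/= ge_min lexx. Qed.

Lemma clamp_eq0 x : x <= 0 -> clamp x = 0.
Proof.
by move=> x0; rewrite /clamp min_r ?max_l// (le_trans x0).
Qed.

Lemma clamp_eq1 x : 1 <= x -> clamp x = 1.
Proof. by move=> x1; rewrite /clamp min_l// max_r. Qed.

Lemma clamp_neq0 x : clamp x != 0 -> 0 < x.
Proof. by rewrite ltNge; apply: contra => /clamp_eq0 ->. Qed.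

Lemma clamp_neq1 x : clamp x != 1 -> x < 1.
Proof. by rewrite ltNge; apply: contra => /clamp_eq1 ->. Qed.

Lemma closed_in_le D f g : cont_in D f -> cont_in D g ->
  closed_in D [set x | f x <= g x].
Proof.
move=> cf cg x Dx /= /negP; rewrite -ltNge => gf.
have := cont_inB cf cg Dx; move/cvgrPdist_lt => /(_ (f x - g x)).
rewrite subr_gt0 => /(_ gf); rewrite !near_withinE; apply: filterS => y H Dy.
have {H} := H Dy; rewrite ltr_norml => /andP[_ H] /= h.
by lra.
Qed.

Lemma closed_in_eq (U : topologicalType) D (f g : T -> U) : hausdorff_space U ->
  cont_in D f -> cont_in D g -> closed_in D [set x | f x = g x].
Proof.
rewrite open_hausdorff => hU cf cg x Dx /= /eqP /hU[[A B]/=].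
move=> [/set_mem Af /set_mem Bg] [oA oB AB0].
have HA : nbhs x [set y | D y -> A (f y)].
  by apply: (cf x Dx); apply: open_nbhs_nbhs.
have HB : nbhs x [set y | D y -> B (g y)].
  by apply: (cg x Dx); apply: open_nbhs_nbhs.
suff : nbhs x [set y | D y -> f y <> g y] by [].
apply: filterS2 HA HB => y /= HA HB Dy fgy.
suff : (A `&` B) (f y) by rewrite (eqP AB0).
by split; [exact: HA|rewrite fgy; exact: HB].
Qed.

End real_cont_in.

(* A continuous map on a compact set is closed onto its image, so the image
   carries the quotient topology. *)
Lemma cont_in_image (L M T : topologicalType) (E : set L) (k : L -> M)
    (f : M -> T) : hausdorff_space M -> compact E ->
  cont_in E k -> cont_in E (f \o k) -> cont_in (k @` E) f.
Proof.
move=> hM cE ck cfk; apply/cont_inP/continuous_closedP => C cC.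
have/cont_inP/continuous_closedP/(_ _ cC)/closed_subspaceP[C' cC' C'E] := cfk.
apply/closed_subspaceP; exists (k @` (C' `&` E)).
  apply: compact_closed => //; apply: continuous_compact.
    by apply/cont_inP; apply: cont_in_sub ck => ? [].
  by rewrite setIC; exact: compact_closedI.
apply/seteqP; split.
  move=> _ [[l [C'l El] <-] kE]; split => //.
  by have [] : ((f \o k) @^-1` C `&` E) l by rewrite -C'E.
move=> y [fC [l El lE]]; split; last by exists l.
exists l => //; split => //.
suff : (C' `&` E) l by case.
by rewrite C'E; split => //; suff : C (f (k l)) by []; rewrite lE.
Qed.

(** * Homotopies *)

Section homotopy_in.
Variables (R : realType) (M Y : topologicalType) (D : set M) (p : M) (q : Y).
Implicit Types (f g h : M -> Y).

(* The time parameter ranges over all of [R], so that reparametrizations need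
   no side condition. *)
Definition hom_in f g := exists H : R * M -> Y,
  [/\ cont_in (setT `*` D) H, forall x, D x -> H (0, x) = f x,
      forall x, D x -> H (1, x) = g x & forall t, H (t, p) = q].

Lemma hom_in_refl f : cont_in D f -> f p = q -> hom_in f f.
Proof.
move=> cf fp; exists (fun tx : R * M => f tx.2); split => //.
apply: (cont_in_comp cf); last by case=> ? ? [].
by apply: cont_in_snd; exact: cont_in_id.
Qed.

Lemma hom_in_sym f g : hom_in f g -> hom_in g f.
Proof.
move=> [H [cH H0 H1 Hp]]; exists (fun tx : R * M => H (1 - tx.1, tx.2)); split.
- apply: (cont_in_comp (f := fun tx : R * M => (1 - tx.1, tx.2)) cH); last by case=> ? ? [].
  apply: cont_in_pair; last by apply: cont_in_snd; exact: cont_in_id.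
  by apply: cont_inB; [exact: cont_in_cst|apply: cont_in_fst; exact: cont_in_id].
- by move=> x Dx /=; rewrite subr0 H1.
- by move=> x Dx /=; rewrite subrr H0.
- by move=> t /=; rewrite Hp.
Qed.

Lemma hom_in_trans f g h : hom_in f g -> hom_in g h -> hom_in f h.
Proof.
move=> [H [cH H0 H1 Hp]] [K [cK K0 K1 Kp]].
exists (fun tx : R * M => if tx.1 <= 2^-1 then H (2 * tx.1, tx.2)
                  else K (2 * tx.1 - 1, tx.2)); split.
- have c1 E : cont_in E (fun tx : R * M => 2 * tx.1).
    by apply: cont_inM; [exact: cont_in_cst|apply: cont_in_fst; exact: cont_in_id].
  have c2 E : cont_in E (fun tx : R * M => tx.2).
    by apply: cont_in_snd; exact: cont_in_id.
  apply: (glue_in (A := [set tx : R * M | 2 * tx.1 <= 1])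
    (B := [set tx : R * M | 1 <= 2 * tx.1])).
  + by move=> [t x] _ /=; have [] := leP (2 * t) 1; [left|right; exact: ltW].
  + by apply: closed_in_le; [|exact: cont_in_cst].
  + by apply: closed_in_le; [exact: cont_in_cst|].
  + apply: (cont_in_eq (f := fun tx : R * M => H (2 * tx.1, tx.2))).
      by move=> [t x] [_ /= t1]; rewrite ifT//; lra.
    apply: (cont_in_comp (f := fun tx : R * M => (2 * tx.1, tx.2)) cH).
      by apply: cont_in_pair.
    by move=> [t x] [[]].
  + apply: (cont_in_eq (f := fun tx : R * M => K (2 * tx.1 - 1, tx.2))).
      move=> [t x] [[_ Dx] /= t1]; case: ifPn => // t2.
      have -> : 2 * t = 1 by lra.
      by rewrite subrr K0// H1.
    apply: (cont_in_comp (f := fun tx : R * M => (2 * tx.1 - 1, tx.2)) cK).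
      by apply: cont_in_pair => //; apply: cont_inB => //; exact: cont_in_cst.
    by move=> [t x] [[]].
- by move=> x Dx /=; rewrite ifT ?invr_ge0// mulr0 H0.
- move=> x Dx /=; rewrite ifF; last by apply/negbTE; rewrite -ltNge; lra.
  by rewrite (_ : 2 * 1 - 1 = 1) ?K1//; lra.
- by move=> t /=; case: ifP.
Qed.

End homotopy_in.

Section based_homotopy.
Variables (R : realType) (X Y : ptopologicalType).
Implicit Types f g h : X -> Y.

Definition hom f g := hom_in R [set: X] point point f g.

Definition based_cont f := continuous f /\ f point = point.

Lemma homP f g : hom f g <-> exists H : R * X -> Y,
  [/\ continuous H, forall x, H (0, x) = f x,
      forall x, H (1, x) = g x & forall t, H (t, point) = point].
Proof.
split=> -[H [cH H0 H1 Hp]]; exists H; split => //.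
- by apply/cont_inT; rewrite -setXTT.
- by move=> x; rewrite H0.
- by move=> x; rewrite H1.
- by rewrite setXTT; apply/cont_inT.
Qed.

Lemma hom_refl f : based_cont f -> hom f f.
Proof. by move=> [cf fp]; apply: hom_in_refl => //; exact/cont_inT. Qed.

Lemma hom_sym f g : hom f g -> hom g f.
Proof. exact: hom_in_sym. Qed.

Lemma hom_trans g f h : hom f g -> hom g h -> hom f h.
Proof. exact: hom_in_trans. Qed.

Lemma hom_based_cont f g : hom f g -> based_cont g.
Proof.
move=> /homP[H [cH H0 H1 Hp]]; split; last by rewrite -H1.
have -> : g = H \o (fun x => (1, x)) by apply/funext => x /=; rewrite H1.
apply/cont_inT; apply: (cont_in_comp (D := setT)) => //; first exact/cont_inT.
by apply: cont_in_pair; [exact: cont_in_cst|exact: cont_in_id].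
Qed.

Lemma hom_based_contl f g : hom f g -> based_cont f.
Proof. by move=> /hom_sym/hom_based_cont. Qed.

(** The result at [x] depends only on [x] and [f x]. Such pointwise operations preserve coincidences
    of maps, hence identities between ensembles tested on finite sets. *)
Definition move_along (q : R * X -> Y) (s : X -> R) f : X -> Y :=
  fun x => if s x == 0 then f x else q (s x, x).

(** Scaling the time [s] gives the homotopy. Its two formulas live on the zero set of [s] and on the
    coincidence set of [q (0, _)] and [f]. Both are closed, the latter since [Y] is Hausdorff; they
    cover, and the formulas agree on the overlap. *)
Lemma move_along_hom q s f : hausdorff_space Y -> based_cont f ->
  continuous q -> (forall t, q (t, point) = point) -> continuous s ->
  (forall x, s x != 0 -> q (0, x) = f x) -> hom f (move_along q s f).
Proof.
move=> hY [cf fp] cq qp cs qf.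
exists (fun tx : R * X => if s tx.2 == 0 then f tx.2 else q (tx.1 * s tx.2, tx.2)).
have c1 E : cont_in E (fun tx : R * X => tx.1) by apply: cont_in_fst; exact: cont_in_id.
have c2 E : cont_in E (fun tx : R * X => tx.2) by apply: cont_in_snd; exact: cont_in_id.
have cs2 E : cont_in E (fun tx : R * X => s tx.2).
  by apply: (cont_in_comp (D := setT)) (c2 E) _ => //; exact/cont_inT.
have cf2 E : cont_in E (fun tx : R * X => f tx.2).
  by apply: (cont_in_comp (D := setT)) (c2 E) _ => //; exact/cont_inT.
have cq2 E (r : R * X -> R) : cont_in E r ->
    cont_in E (fun tx : R * X => q (r tx, tx.2)).
  move=> cr; apply: (cont_in_comp (D := setT) (g := q)
    (f := fun tx : R * X => (r tx, tx.2))) => //.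
    exact/cont_inT.
  exact: cont_in_pair.
split.
- apply: (glue_in (A := [set tx : R * X | s tx.2 = 0])
    (B := [set tx : R * X | q (0, tx.2) = f tx.2])).
  + by move=> [t x] _ /=; case: (eqVneq (s x) 0) => [sx|/qf sx]; [left|right].
  + by apply: closed_in_eq => //; exact: cont_in_cst.
  + by apply: closed_in_eq => //; apply: cq2; exact: cont_in_cst.
  + by apply: (cont_in_eq (f := fun tx : R * X => f tx.2)) => // tx [_ /= ->]; rewrite eqxx.
  + apply: (cont_in_eq (f := fun tx : R * X => q (tx.1 * s tx.2, tx.2))).
      by move=> tx [_ /= qE]; case: eqP => // ->; rewrite mulr0.
    by apply: cq2; exact: cont_inM.
- by move=> x _ /=; case: eqVneq => // /qf; rewrite mul0r.
- by move=> x _ /=; rewrite mul1r.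
- by move=> t /=; case: ifP.
Qed.

End based_homotopy.

(** * Attaching a cell *)

Section rV.
Variables (R : realType) (n : nat).
Implicit Types (a b v : 'rV[R]_n) (T : topologicalType).

Lemma cont_in_coord T (D : set T) (f : T -> 'rV[R]_n) i :
  cont_in D f -> cont_in D (fun x => f x ord0 i).
Proof.
move=> cf; apply: (cont_in_comp (D := setT) (g := fun v : 'rV[R]_n => v ord0 i)) cf _ => //.
by apply: continuous_in; exact: coord_continuous.
Qed.

Lemma cont_in_rV T (D : set T) (f : T -> 'rV[R]_n) :
  (forall i, cont_in D (fun x => f x ord0 i)) -> cont_in D f.
Proof.
move=> cf x Dx W [P PW PWs] /=.
suff : nbhs x [set y | D y -> W (f y)] by [].
have H i : nbhs x [set y | D y -> P ord0 i (f y ord0 i)] by exact: cf.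
have : nbhs x [set y | forall i, D y -> P ord0 i (f y ord0 i)] by exact: filter_forall.
apply: filterS => y Hy Dy; apply: PWs => i j; rewrite (ord1 i).
exact: Hy.
Qed.

Lemma cont_inZ T (D : set T) (k : T -> R) (f : T -> 'rV[R]_n) :
  cont_in D k -> cont_in D f -> cont_in D (fun x => k x *: f x).
Proof.
move=> ck cf; apply: cont_in_rV => i.
apply: (cont_in_eq (f := fun x => k x * f x ord0 i)).
  by move=> x _; rewrite mxE.
by apply: cont_inM => //; exact: cont_in_coord.
Qed.

Lemma cont_in_rVD T (D : set T) (f g : T -> 'rV[R]_n) :
  cont_in D f -> cont_in D g -> cont_in D (fun x => f x + g x).
Proof.
move=> cf cg; apply: cont_in_rV => i.
apply: (cont_in_eq (f := fun x => f x ord0 i + g x ord0 i)).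
  by move=> x _; rewrite mxE.
by apply: cont_inD; exact: cont_in_coord.
Qed.

Lemma cont_in_sqnorm T (D : set T) (f : T -> 'rV[R]_n) :
  cont_in D f -> cont_in D (fun x => sqnorm (f x)).
Proof.
move=> cf; rewrite /sqnorm.
suff H (s : seq 'I_n) : cont_in D (fun x => \sum_(i <- s) f x ord0 i ^+ 2) by exact: H.
elim: s => [|i s IH].
  by apply: (cont_in_eq (f := fun=> 0)) => [x _|]; [rewrite big_nil|exact: cont_in_cst].
apply: (cont_in_eq (f := fun x => f x ord0 i * f x ord0 i + \sum_(i <- s) f x ord0 i ^+ 2)).
  by move=> x _; rewrite big_cons expr2.
by apply: cont_inD => //; apply: cont_inM; exact: cont_in_coord.
Qed.

Lemma sqnorm_ge0 v : 0 <= sqnorm v.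
Proof. by apply: sumr_ge0 => i _; exact: sqr_ge0. Qed.

Lemma sqnorm0 : sqnorm (0 : 'rV[R]_n) = 0.
Proof. by rewrite /sqnorm big1// => i _; rewrite mxE expr0n. Qed.

Lemma sqnormZ k v : sqnorm (k *: v) = k ^+ 2 * sqnorm v.
Proof. by rewrite /sqnorm mulr_sumr; apply: eq_bigr => i _; rewrite mxE exprMn. Qed.

Lemma sqnorm_convex t a b : 0 <= t <= 1 ->
  sqnorm ((1 - t) *: a + t *: b) <= (1 - t) * sqnorm a + t * sqnorm b.
Proof.
move=> /andP[t0 t1]; rewrite /sqnorm !mulr_sumr -big_split/=.
apply: ler_sum => i _; rewrite !mxE.
(* This term is the difference of the two sides in coordinate [i]. *)
have : 0 <= t * (1 - t) * (a ord0 i - b ord0 i) ^+ 2.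
  by rewrite mulr_ge0 ?sqr_ge0// mulr_ge0// subr_ge0.
by nra.
Qed.

Lemma closed_disc_compact : compact (closed_disc R n).
Proof.
have cI : compact [set v : 'rV[R]_n | forall i, `[-1, 1]%classic (v ord0 i)].
  by apply: (@rV_compact R n (fun=> `[-1, 1]%classic)) => i; exact: segment_compact.
apply: (subclosed_compact _ cI).
  rewrite (_ : closed_disc R n = (@sqnorm R n) @^-1` [set x | x <= 1]) //.
  apply: preimage_closed; last exact: closed_le.
  move=> v _; move: v; apply/cont_inT.
  by apply: cont_in_sqnorm; exact: cont_in_id.
move=> v; rewrite /closed_disc/= => v1 i; rewrite in_itv/= -ler_norml.
rewrite -(@ler_pXn2r _ 2) ?nnegrE// expr1n; apply: le_trans v1.
rewrite real_normK ?num_real// /sqnorm (bigD1 i)//= lerDl.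
by rewrite sumr_ge0// => j _; rewrite sqr_ge0.
Qed.

Lemma open_disc_closed : open_disc R n `<=` closed_disc R n.
Proof. by move=> v; exact: ltW. Qed.

Lemma closed_disc_cases v : closed_disc R n v -> open_disc R n v \/ unit_sphere R n v.
Proof.
by rewrite /closed_disc/open_disc/unit_sphere/= le_eqVlt => /orP[/eqP|]; [right|left].
Qed.

End rV.

Lemma hausdorff_prod (T U : topologicalType) :
  hausdorff_space T -> hausdorff_space U -> hausdorff_space (T * U)%type.
Proof.
move=> hT hU [t u] [t' u'] cl; congr pair; [apply: hT|apply: hU] => A B nA nB.
  have [||[a b] [[? _] [? _]]] := cl (A `*` setT) (B `*` setT); last by exists a.
    by exists (A, setT) => //; split => //; exact: filterT.
  by exists (B, setT) => //; split => //; exact: filterT.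
have [||[a b] [[_ ?] [_ ?]]] := cl (setT `*` A) (setT `*` B); last by exists b.
  by exists (setT, A) => //; split => //; exact: filterT.
by exists (setT, B) => //; split => //; exact: filterT.
Qed.

(* A weak form of local equiconnectedness: on the neighbourhood [u != 0] of the
   diagonal, [Psi] forgets its second argument. *)
Definition merging (R : realType) (Y : ptopologicalType) (S : set Y) :=
  exists (Psi : Y * Y -> Y) (u : Y * Y -> R),
  [/\ hom_in R (S `*` S) (point, point) point snd Psi,
      cont_in (S `*` S) u, forall z, S z -> u (z, z) = 1 &
      forall z y, S z -> S y -> u (z, y) != 0 -> Psi (z, y) = Psi (z, z)].

Section attach_cell.
Variables (R : realType) (Y : ptopologicalType) (n : nat).
Variables (chi : 'rV[R]_n -> Y) (S : set Y).
Hypotheses (hY : hausdorff_space Y) (chi_cont : cont_in (closed_disc R n) chi).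
Hypotheses (chi_inj : set_inj (open_disc R n) chi) (S_compact : compact S).
Hypotheses (S_point : S point).
Hypotheses (chi_sphere : chi @` unit_sphere R n `<=` S).
Hypotheses (chi_disj : forall v, open_disc R n v -> ~ S (chi v)).

Let I01 : set R := `[0, 1]%classic.
Let cellS := chi @` open_disc R n.
Let S' := S `|` cellS.

Let mem01 t : I01 t = (0 <= t <= 1).
Proof. by rewrite /I01/= in_itv. Qed.

Lemma attach_chi v : closed_disc R n v -> S' (chi v).
Proof.
by move=> /closed_disc_cases[?|?]; [right; exists v|left; apply: chi_sphere; exists v].
Qed.

Lemma attachE : S' = S `|` chi @` closed_disc R n.
Proof.
apply/seteqP; split => y [Sy|[v Dv <-]]; [by left| |by left|exact: attach_chi].
by right; exists v => //; exact: open_disc_closed.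
Qed.

Lemma attach_compact : compact S'.
Proof.
rewrite attachE; apply: compactU => //.
by apply: continuous_compact; [exact/cont_inP|exact: closed_disc_compact].
Qed.

(** The product is glued from two closed pieces, over [S] and over the closed cell. The second is
    the image of a compact set, so continuity there can be tested after composing with [chi]. *)
Lemma cont_in_attach (T : topologicalType) (f : R * Y -> T) :
  cont_in (I01 `*` S) f ->
  cont_in (I01 `*` closed_disc R n) (fun tv => f (tv.1, chi tv.2)) ->
  cont_in (I01 `*` S') f.
Proof.
move=> fS fchi.
have cI : compact I01 by exact: segment_compact.
have hRY : hausdorff_space (R * Y)%type.
  by apply: hausdorff_prod => //; exact: Rhausdorff.
have cD : compact (chi @` closed_disc R n).
  by apply: continuous_compact; [exact/cont_inP|exact: closed_disc_compact].
have cl (A : set Y) : compact A -> closed (I01 `*` A).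
  by move=> cA; exact: (compact_closed hRY (compact_setX cI cA)).
apply: (glue_in (A := I01 `*` S) (B := I01 `*` (chi @` closed_disc R n))).
- by rewrite attachE => -[t y] [/= t01 [Sy|Dy]]; [left|right].
- exact/closed_closed_in/cl.
- exact/closed_closed_in/cl.
- by apply: cont_in_sub fS => ? [].
pose k (tv : R * 'rV[R]_n) := (tv.1, chi tv.2).
apply: (cont_in_sub (E := k @` (I01 `*` closed_disc R n))).
  by move=> [t y] [_ [/= t01 [v Dv <-]]]; exists (t, v).
apply: cont_in_image => //.
- exact: (compact_setX cI (@closed_disc_compact R n)).
- apply: cont_in_pair; first by apply: cont_in_fst; exact: cont_in_id.
  apply: (cont_in_comp chi_cont); last by case=> ? ? [].
  by apply: cont_in_snd; exact: cont_in_id.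
Qed.

Lemma cont_in_attach0 (T : topologicalType) (f : Y -> T) :
  cont_in S f -> cont_in (closed_disc R n) (f \o chi) -> cont_in S' f.
Proof.
move=> fS fchi.
have H : cont_in (I01 `*` S') (fun ty : R * Y => f ty.2).
  apply: cont_in_attach.
    apply: (cont_in_comp fS); last by case=> ? ? [].
    by apply: cont_in_snd; exact: cont_in_id.
  apply: (cont_in_comp fchi); last by case=> ? ? [].
  by apply: cont_in_snd; exact: cont_in_id.
apply: (cont_in_comp (f := fun y => (0, y) : R * Y)) H _ _.
  by apply: cont_in_pair; [exact: cont_in_cst|exact: cont_in_id].
by move=> y Sy; split => //=; rewrite mem01 lexx ler01.
Qed.

(** * Coordinates on the attached cell *)

Definition cell_inv y := xget 0 [set v | open_disc R n v /\ chi v = y].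

Lemma cell_invP y : cellS y -> open_disc R n (cell_inv y) /\ chi (cell_inv y) = y.
Proof.
move=> [v Dv vy]; rewrite /cell_inv; case: xgetP => [w _ //|/(_ v)].
by case; split.
Qed.

Lemma cell_invK v : open_disc R n v -> cell_inv (chi v) = v.
Proof.
move=> Dv; have [Dw ?] : open_disc R n (cell_inv (chi v)) /\ chi (cell_inv (chi v)) = chi v.
  by apply: cell_invP; exists v.
by apply: chi_inj; rewrite ?inE.
Qed.

Lemma cellS_notS y : cellS y -> ~ S y.
Proof. by move=> [v Dv <-]; exact: chi_disj. Qed.

Definition height y : R := if `[< cellS y >] then 1 - sqnorm (cell_inv y) else 0.

(** In general [cell_inv] does not extend continuously over [S], but its product with [height],
    which vanishes on [S], does. Where [height] is nonzero, [cell_inv] is recovered as a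
    quotient. *)
Definition vcoord y : 'rV[R]_n := height y *: cell_inv y.

Lemma heightS y : S y -> height y = 0.
Proof. by rewrite /height; case: asboolP => // /cellS_notS. Qed.

Lemma height_chi v : closed_disc R n v -> height (chi v) = 1 - sqnorm v.
Proof.
move=> /closed_disc_cases[Dv|Sv].
  rewrite /height; case: asboolP => [_|]; first by rewrite cell_invK.
  by case; exists v.
by rewrite heightS ?Sv ?subrr//; apply: chi_sphere; exists v.
Qed.

Lemma height_neq0 y : height y != 0 -> cellS y.
Proof. by rewrite /height; case: asboolP => //; rewrite eqxx. Qed.

Lemma vcoordS y : S y -> vcoord y = 0.
Proof. by rewrite /vcoord => /heightS ->; rewrite scale0r. Qed.

Lemma vcoord_chi v : closed_disc R n v -> vcoord (chi v) = (1 - sqnorm v) *: v.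
Proof.
move=> Dv; rewrite /vcoord height_chi//.
case/closed_disc_cases: Dv => [Dv|Sv]; first by rewrite cell_invK.
by rewrite Sv subrr !scale0r.
Qed.

Lemma cell_invE y : height y != 0 -> cell_inv y = (height y)^-1 *: vcoord y.
Proof. by move=> h0; rewrite /vcoord scalerA mulVf// scale1r. Qed.

Lemma cont_in_sqnorm_id (D : set 'rV[R]_n) : cont_in D (@sqnorm R n).
Proof. by apply: cont_in_sqnorm; exact: cont_in_id. Qed.

Lemma height_cont : cont_in S' height.
Proof.
apply: cont_in_attach0.
  by apply: (cont_in_eq (f := fun=> 0 : R)) => [y /heightS //|]; exact: cont_in_cst.
apply: (cont_in_eq (f := fun v => 1 - sqnorm v)) => [v /height_chi //|].
by apply: cont_inB; [exact: cont_in_cst|exact: cont_in_sqnorm_id].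
Qed.

Lemma vcoord_cont : cont_in S' vcoord.
Proof.
apply: cont_in_attach0.
  by apply: (cont_in_eq (f := fun=> 0 : 'rV[R]_n)) => [y /vcoordS //|]; exact: cont_in_cst.
apply: (cont_in_eq (f := fun v => (1 - sqnorm v) *: v)) => [v /vcoord_chi //|].
apply: cont_inZ; last exact: cont_in_id.
by apply: cont_inB; [exact: cont_in_cst|exact: cont_in_sqnorm_id].
Qed.

(* The factor [3/4] is such that, at time [1], every point of height at most
   [15/16] has been pushed into [S]. *)
Definition rscale (t : R) (v : 'rV[R]_n) : R :=
  (Num.max (1 - 3 / 4 * t) (Num.sqrt (sqnorm v)))^-1.

Definition rpush (ty : R * Y) : Y :=
  if `[< cellS ty.2 >] then chi (rscale ty.1 (cell_inv ty.2) *: cell_inv ty.2)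
  else ty.2.

Lemma rscale_pos (t : R) (v : 'rV[R]_n) : 0 <= t <= 1 ->
  0 < Num.max (1 - 3 / 4 * t) (Num.sqrt (sqnorm v)).
Proof. by move=> /andP[t0 t1]; rewrite lt_max; apply/orP; left; lra. Qed.

Lemma rscale_disc t v : 0 <= t <= 1 -> closed_disc R n (rscale t v *: v).
Proof.
move=> t01; rewrite /closed_disc/= sqnormZ /rscale exprVn mulrC.
rewrite ler_pdivrMr ?exprn_gt0 ?rscale_pos// mul1r.
rewrite -[leLHS]sqr_sqrtr ?sqnorm_ge0// ler_pXn2r ?nnegrE ?sqrtr_ge0//.
  by rewrite le_max lexx orbT.
by rewrite ltW// rscale_pos.
Qed.

Lemma rscale_sphere t v : unit_sphere R n v -> 0 <= t <= 1 -> rscale t v = 1.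
Proof.
rewrite /unit_sphere/= /rscale => -> /andP[t0 t1].
by rewrite sqrtr1 max_r ?invr1//; lra.
Qed.

Lemma rpush_chi t v : 0 <= t <= 1 -> closed_disc R n v ->
  rpush (t, chi v) = chi (rscale t v *: v).
Proof.
move=> t01 /closed_disc_cases[Dv|Sv]; rewrite /rpush /=.
  by case: asboolP => [_|[]]; [rewrite cell_invK|exists v].
case: asboolP => [/cellS_notS[]|_]; first by apply: chi_sphere; exists v.
by rewrite rscale_sphere// scale1r.
Qed.

Lemma rpushS t y : S y -> rpush (t, y) = y.
Proof. by rewrite /rpush /=; case: asboolP => // /cellS_notS. Qed.

Lemma rpush0 y : rpush (0, y) = y.
Proof.
rewrite /rpush /=; case: asboolP => // /cell_invP[Dv vy].
rewrite /rscale mulr0 subr0 max_l ?invr1 ?scale1r//.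
by rewrite -sqrtr1 ler_wsqrtr// ltW.
Qed.

Lemma rpush1 y : S' y -> height y <= 15 / 16 -> S (rpush (1, y)).
Proof.
move=> [Sy|]; first by rewrite rpushS.
move=> [v Dv <-]; have Dv' := open_disc_closed Dv.
have i01 : 0 <= (1 : R) <= 1 by rewrite ler01 lexx.
rewrite height_chi// rpush_chi// => vh; apply: chi_sphere.
have sv0 : 4^-1 <= Num.sqrt (sqnorm v).
  rewrite -(@ler_pXn2r _ 2) ?nnegrE ?sqrtr_ge0 ?invr_ge0// sqr_sqrtr ?sqnorm_ge0//.
  by rewrite expr2; lra.
exists (rscale 1 v *: v) => //; rewrite /unit_sphere/= sqnormZ /rscale max_r; last by lra.
rewrite exprVn sqr_sqrtr ?sqnorm_ge0// mulVf//.
by apply/eqP => v0; rewrite v0 sqrtr0 in sv0; lra.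
Qed.

Lemma rpush_cont : cont_in (I01 `*` S') rpush.
Proof.
have c1 (D : set (R * 'rV[R]_n)) : cont_in D (fun tv => tv.1).
  by apply: cont_in_fst; exact: cont_in_id.
have c2 (D : set (R * 'rV[R]_n)) : cont_in D (fun tv => tv.2).
  by apply: cont_in_snd; exact: cont_in_id.
apply: cont_in_attach.
  apply: (cont_in_eq (f := fun ty : R * Y => ty.2)) => [[t y] [_ /= /rpushS ->//]|].
  by apply: cont_in_snd; exact: cont_in_id.
apply: (cont_in_eq (f := fun tv : R * 'rV[R]_n => chi (rscale tv.1 tv.2 *: tv.2))).
  by move=> [t v] [/=]; rewrite mem01 => t01 Dv; rewrite rpush_chi.
apply: (cont_in_comp chi_cont); last first.
  by move=> [t v] [/=]; rewrite mem01 => t01 Dv; exact: rscale_disc.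
apply: cont_inZ => //; apply: cont_inV.
  by move=> [t v] [/=]; rewrite mem01 => t01 Dv; rewrite gt_eqF// rscale_pos.
apply: cont_in_max.
  by apply: cont_inB; [|apply: cont_inM => //]; exact: cont_in_cst.
apply: (cont_in_comp (D := setT) (g := @Num.sqrt R)) => //.
  by apply/cont_inT; exact: sqrt_continuous.
exact: cont_in_sqnorm.
Qed.

(** * Motion towards the diagonal *)

Let D2 := S' `*` S'.
(** For a pair of points [z], [y] in the cell, [y1] moves [y] towards [z] along a segment of the
    disc. The cut-off [kap] is nonzero only if [z] has height above 1/4 and [dist] is below 1/8,
    which forces [y] to have height above 1/8, so that the segment is defined. It equals 1 once the
    height of [z] is at least 3/8 and [dist] is at most 1/16. *)
Let dist (zy : Y * Y) : R :=
  `|height zy.1 - height zy.2| + sqnorm (vcoord zy.1 - vcoord zy.2).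
Let kap (zy : Y * Y) : R := clamp (8 * height zy.1 - 2) * clamp (2 - 16 * dist zy).
Let mid t zy := (1 - t * kap zy) *: cell_inv zy.2 + (t * kap zy) *: cell_inv zy.1.
Let y1 t zy := if kap zy == 0 then zy.2 else chi (mid t zy).

Let dist_height zy : `|height zy.1 - height zy.2| <= dist zy.
Proof. by rewrite lerDl sqnorm_ge0. Qed.

Let dist_diag z : dist (z, z) = 0.
Proof. by rewrite /dist !subrr normr0 sqnorm0 addr0. Qed.

Let hpos y : 0 < height y -> open_disc R n (cell_inv y) /\ chi (cell_inv y) = y.
Proof. by move=> h0; apply/cell_invP/height_neq0; rewrite gt_eqF. Qed.

Let kapP zy : kap zy != 0 -> 1 / 4 < height zy.1 /\ 1 / 8 < height zy.2.
Proof.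
rewrite mulf_eq0 negb_or => /andP[/clamp_neq0 h1 /clamp_neq0 h2].
have := dist_height zy; rewrite ler_norml => /andP[h3 h4].
by split; lra.
Qed.

Let kap01 zy : 0 <= kap zy <= 1.
Proof.
by rewrite mulr_ge0 ?clamp_ge0//= mulr_ile1 ?clamp_ge0 ?clamp_le1.
Qed.

Let mid_disc t zy : 0 <= t <= 1 -> kap zy != 0 -> closed_disc R n (mid t zy).
Proof.
move=> /andP[t0 t1] /kapP[h1 h2].
have [k0 k1] := andP (kap01 zy).
have tk : 0 <= t * kap zy <= 1 by rewrite mulr_ge0//= mulr_ile1.
rewrite /closed_disc/=; apply: le_trans (sqnorm_convex _ _ tk) _.
have /hpos[D1 _] : 0 < height zy.1 by lra.
have /hpos[D2' _] : 0 < height zy.2 by lra.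
move: D1 D2' tk; rewrite /open_disc/= => D1 D2' /andP[tk0 tk1].
have p1 : 0 <= (t * kap zy) * (1 - sqnorm (cell_inv zy.1)).
  by rewrite mulr_ge0// subr_ge0 ltW.
have p2 : 0 <= (1 - t * kap zy) * (1 - sqnorm (cell_inv zy.2)).
  by rewrite mulr_ge0// subr_ge0// ltW.
by nra.
Qed.

Let y1S' t zy : 0 <= t <= 1 -> D2 zy -> S' (y1 t zy).
Proof.
move=> t01 [_ Sy]; rewrite /y1; case: ifPn => // k0.
by apply: attach_chi; exact: mid_disc.
Qed.

Let y1_0 zy : y1 0 zy = zy.2.
Proof.
rewrite /y1; case: eqP => // /eqP /kapP[h1 h2].
rewrite /mid mul0r subr0 scale1r scale0r addr0.
by have /hpos[] : 0 < height zy.2 by lra.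
Qed.

Let y1_diag t z : y1 t (z, z) = z.
Proof.
rewrite /y1; case: eqP => // /eqP /kapP[h1 h2].
rewrite /mid /= -scalerDl subrK scale1r.
by have /hpos[] : 0 < height z by move: h1 => /=; lra.
Qed.

Let y1_near zy : kap zy = 1 -> y1 1 zy = zy.1.
Proof.
move=> k1; have /kapP[h1 h2] : kap zy != 0 by rewrite k1 oner_neq0.
rewrite /y1 k1 oner_eq0 /mid k1 mulr1 subrr scale0r add0r scale1r.
by have /hpos[] : 0 < height zy.1 by lra.
Qed.

Let height_comp (T : topologicalType) (E : set T) (w : T -> Y) :
  cont_in E w -> (forall x, E x -> S' (w x)) -> cont_in E (fun x => height (w x)).
Proof. by move=> cw wS'; exact: cont_in_comp height_cont cw wS'. Qed.

Let vcoord_comp (T : topologicalType) (E : set T) (w : T -> Y) :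
  cont_in E w -> (forall x, E x -> S' (w x)) -> cont_in E (fun x => vcoord (w x)).
Proof. by move=> cw wS'; exact: cont_in_comp vcoord_cont cw wS'. Qed.

Let dist_cont : cont_in D2 dist.
Proof.
have c1 : cont_in D2 (fun zy => zy.1) by apply: cont_in_fst; exact: cont_in_id.
have c2 : cont_in D2 (fun zy => zy.2) by apply: cont_in_snd; exact: cont_in_id.
have d1 zy : D2 zy -> S' zy.1 by case.
have d2 zy : D2 zy -> S' zy.2 by case.
apply: cont_inD.
  by apply: cont_in_norm; apply: cont_inB; exact: height_comp.
apply: cont_in_sqnorm; apply: cont_in_rVD; first exact: vcoord_comp.
apply: (cont_in_eq (f := fun zy => (- 1) *: vcoord zy.2)).
  by move=> x _; rewrite scaleN1r.
by apply: cont_inZ; [exact: cont_in_cst|exact: vcoord_comp].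
Qed.

Let affine_cont (T : topologicalType) (E : set T) (a b : R) (f : T -> R) :
  cont_in E f -> cont_in E (fun x => a * f x + b).
Proof.
move=> cf; apply: cont_inD; last exact: cont_in_cst.
by apply: cont_inM => //; exact: cont_in_cst.
Qed.

Let affine_cont' (T : topologicalType) (E : set T) (a b : R) (f : T -> R) :
  cont_in E f -> cont_in E (fun x => b - a * f x).
Proof.
move=> cf; apply: cont_inB; first exact: cont_in_cst.
by apply: cont_inM => //; exact: cont_in_cst.
Qed.

Let kap_cont : cont_in D2 kap.
Proof.
apply: cont_inM; apply: cont_in_clamp; last by apply: affine_cont'; exact: dist_cont.
apply: affine_cont; apply: height_comp; last by move=> ? [].
by apply: cont_in_fst; exact: cont_in_id.
Qed.

Let I01D2 (T : topologicalType) (g : Y * Y -> T) : cont_in D2 g ->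
  cont_in (I01 `*` D2) (fun p => g p.2).
Proof.
move=> cg; apply: (cont_in_comp cg); last by move=> ? [].
by apply: cont_in_snd; exact: cont_in_id.
Qed.

(** Two closed sets are glued: the one where [kap] vanishes and [y] stays put, and one where both
    heights are bounded below, so that [cell_inv] is the continuous quotient of [vcoord] by
    [height]. *)
Let y1_cont : cont_in (I01 `*` D2) (fun p => y1 p.1 p.2).
Proof.
have ct E : cont_in E (fun p : R * (Y * Y) => p.1) by apply: cont_in_fst; exact: cont_in_id.
have c1 : cont_in D2 (fun zy => zy.1) by apply: cont_in_fst; exact: cont_in_id.
have c2 : cont_in D2 (fun zy => zy.2) by apply: cont_in_snd; exact: cont_in_id.
have d1 zy : D2 zy -> S' zy.1 by case.
have d2 zy : D2 zy -> S' zy.2 by case.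
have ch1 := I01D2 (height_comp c1 d1); have ch2 := I01D2 (height_comp c2 d2).
have cv1 := I01D2 (vcoord_comp c1 d1); have cv2 := I01D2 (vcoord_comp c2 d2).
have ck := I01D2 kap_cont.
pose A := [set p : R * (Y * Y) | kap p.2 = 0].
pose B1 := [set p : R * (Y * Y) | 1 / 4 <= height p.2.1].
pose B2 := [set p : R * (Y * Y) | 1 / 8 <= height p.2.2].
apply: (glue_in (A := A) (B := B1 `&` B2)).
- move=> [t zy] _; case: (eqVneq (kap zy) 0) => [k0|/kapP[h1 h2]]; first by left.
  by right; split; exact: ltW.
- by apply: closed_in_eq => //; exact: cont_in_cst.
- have cB1 : closed_in (I01 `*` D2) B1 by apply: closed_in_le => //; exact: cont_in_cst.
  have cB2 : closed_in (I01 `*` D2) B2 by apply: closed_in_le => //; exact: cont_in_cst.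
  exact: closed_inI.
- apply: (cont_in_eq (f := fun p : R * (Y * Y) => p.2.2)).
    by move=> [t zy] [_ /= k0]; rewrite /y1 k0 eqxx.
  by apply: cont_in_snd; apply: cont_in_snd; exact: cont_in_id.
pose w (p : R * (Y * Y)) :=
  (1 - p.1 * kap p.2) *: ((height p.2.2)^-1 *: vcoord p.2.2) +
  (p.1 * kap p.2) *: ((height p.2.1)^-1 *: vcoord p.2.1).
have midE p : (B1 `&` B2) p -> mid p.1 p.2 = w p.
  by rewrite /B1 /B2 => -[/= h1 h2]; rewrite /mid /w !cell_invE// gt_eqF//; lra.
have sub : (I01 `*` D2) `&` (B1 `&` B2) `<=` I01 `*` D2 by move=> ? [].
apply: (cont_in_eq (f := fun p => chi (w p))).
  rewrite /B1 /B2 => -[t [z y]] [[/= t01 [/= Sz Sy]] [/= h1 h2]]; rewrite /y1.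
  case: eqP => [k0|_]; last by rewrite -midE.
  have /hpos[_] : 0 < height y by lra.
  rewrite -midE//= /mid k0 mulr0 subr0 scale1r scale0r addr0 => {2}<- //.
apply: (cont_in_comp chi_cont); last first.
  move=> [t [z y]] [[/= t01 [/= Sz Sy]] hh]; rewrite -midE//=.
  case: (eqVneq (kap (z, y)) 0) => k0; last by apply: mid_disc => //; rewrite -mem01.
  rewrite /mid k0 mulr0 subr0 scale1r scale0r addr0 /=.
  have /hpos[/open_disc_closed //] : 0 < height y.
  by case: hh; rewrite /B1 /B2 /= => h1 h2; lra.
have ck' := cont_in_sub sub ck.
have ctk : cont_in ((I01 `*` D2) `&` (B1 `&` B2)) (fun p => p.1 * kap p.2).
  exact: cont_inM.
apply: cont_in_rVD; apply: cont_inZ => //.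
- by apply: cont_inB => //; exact: cont_in_cst.
- apply: cont_inZ; last exact: cont_in_sub cv2.
  apply: cont_inV; last exact: cont_in_sub ch2.
  by rewrite /B1 /B2 => -[t [z y]] [_ [/= h1 h2]]; rewrite gt_eqF//; lra.
- apply: cont_inZ; last exact: cont_in_sub cv1.
  apply: cont_inV; last exact: cont_in_sub ch1.
  by rewrite /B1 /B2 => -[t [z y]] [_ [/= h1 h2]]; rewrite gt_eqF//; lra.
Qed.

(** Deep inside the cell, [y1] already moves [y] onto [z]. Far from the centre, both points are
    pushed radially into [S], where the given merging takes over. The two regimes overlap at heights
    of [z] between 3/8 and 5/8, and the new [u] interpolates between them. *)
Lemma merging_attach : merging R S -> merging R S'.
Proof.
move=> [Psi [u [[H [cH H0 H1 Hp]] cu u1 uPsi]]].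
have hp : height point = 0 by exact: heightS.
have I0 : I01 0 by rewrite mem01 lexx ler01.
have I1 : I01 1 by rewrite mem01 lexx ler01.
have y1p t : y1 t (point, point) = point by rewrite y1_diag.
pose g1 (zy : Y * Y) := rpush (1, y1 1 zy).
have clampI x : I01 (clamp x) by rewrite mem01 clamp_ge0 clamp_le1.
(* First stage: [y] moves towards [z] while being pushed radially, both with the same time. *)
have hom1 : hom_in R D2 (point, point) point snd g1.
  exists (fun p : R * (Y * Y) => rpush (clamp p.1, y1 (clamp p.1) p.2)); split.
  - have cc : cont_in (setT `*` D2) (fun p => clamp p.1 : R).
      by apply: cont_in_clamp; apply: cont_in_fst; exact: cont_in_id.
    have c2 : cont_in (setT `*` D2) (fun p : R * (Y * Y) => p.2).
      by apply: cont_in_snd; exact: cont_in_id.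
    apply: (cont_in_comp rpush_cont).
      apply: cont_in_pair => //.
      apply: (cont_in_comp (f := fun p : R * (Y * Y) => (clamp p.1 : R, p.2)) y1_cont).
        exact: cont_in_pair.
      by move=> [t zy] [_ Dzy]; split => //; exact: clampI.
    move=> [t zy] [_ Dzy]; split => /=; first exact: clampI.
    by apply: y1S' => //; rewrite clamp_ge0 clamp_le1.
  - by move=> zy Dzy /=; rewrite clamp_eq0// y1_0 rpush0.
  - by move=> zy Dzy /=; rewrite clamp_eq1.
  - by move=> t /=; rewrite y1p rpushS.
have g1_cont : cont_in D2 g1.
  apply: (cont_in_comp (f := fun zy => (1 : R, y1 1 zy)) rpush_cont).
    apply: cont_in_pair; first exact: cont_in_cst.
    apply: (cont_in_comp (f := fun zy : Y * Y => (1 : R, zy)) y1_cont).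
      by apply: cont_in_pair; [exact: cont_in_cst|exact: cont_in_id].
    by move=> zy Dzy; split.
  by move=> zy Dzy; split => //=; apply: y1S' => //; rewrite ler01 lexx.
have y1c : cont_in D2 (y1 1).
  apply: (cont_in_comp (f := fun zy : Y * Y => (1 : R, zy)) y1_cont).
    by apply: cont_in_pair; [exact: cont_in_cst|exact: cont_in_id].
  by move=> zy Dzy; split.
have ch1 : cont_in D2 (fun zy => height zy.1).
  apply: height_comp; last by move=> ? [].
  by apply: cont_in_fst; exact: cont_in_id.
have y1D zy : D2 zy -> S' (y1 1 zy) by apply: y1S'; rewrite ler01 lexx.
have chy : cont_in D2 (fun zy => height (y1 1 zy)) by exact: height_comp.
pose gap (zy : Y * Y) := `|height zy.1 - height (y1 1 zy)|.
have cgap : cont_in D2 gap by apply: cont_in_norm; exact: cont_inB.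
have gap_diag z : gap (z, z) = 0 by rewrite /gap y1_diag subrr normr0.
(* This cut-off lives on [B], where both [z] and the moved [y] are pushed into [S]: a height below
   3/4 and a gap below 1/8 keep the other height below 15/16. It equals 1 for height at most 5/8 and
   gap at most 1/16. *)
pose kap' (zy : Y * Y) := clamp (6 - 8 * height zy.1) * clamp (2 - 16 * gap zy).
pose B := [set zy : Y * Y | height zy.1 <= 3 / 4] `&`
          [set zy : Y * Y | height (y1 1 zy) <= 15 / 16].
have BP zy : height zy.1 < 3 / 4 -> gap zy < 1 / 8 -> B zy.
  move=> h1; rewrite /gap ltr_norml => /andP[h2 h3]; split => /=; lra.
have kap'B zy : kap' zy != 0 -> B zy.
  rewrite mulf_eq0 negb_or => /andP[/clamp_neq0 h1 /clamp_neq0 h2].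
  by apply: BP; lra.
have BS zy : D2 zy -> B zy -> (S `*` S) (rpush (1, zy.1), g1 zy).
  move=> Dzy [/= h1 h2]; split => /=; last by apply: rpush1 => //; exact: y1D.
  by apply: rpush1; [case: Dzy|lra].
have cB : closed_in D2 B.
  by apply: closed_inI; apply: closed_in_le => //; exact: cont_in_cst.
have crp : cont_in D2 (fun zy => (rpush (1, zy.1), g1 zy)).
  apply: cont_in_pair => //.
  apply: (cont_in_comp (f := fun zy : Y * Y => (1 : R, zy.1)) rpush_cont).
    apply: cont_in_pair; first exact: cont_in_cst.
    by apply: cont_in_fst; exact: cont_in_id.
  by move=> zy [? ?]; split.
have ckap' : cont_in D2 kap'.
  by apply: cont_inM; apply: cont_in_clamp; exact: affine_cont'.
pose H' (p : R * (Y * Y)) := if kap' p.2 == 0 then g1 p.2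
  else H (p.1 * kap' p.2, (rpush (1, p.2.1), g1 p.2)).
have TD2 (T : topologicalType) (g : Y * Y -> T) : cont_in D2 g ->
    cont_in (setT `*` D2) (fun p : R * (Y * Y) => g p.2).
  move=> cg; apply: (cont_in_comp cg); last by move=> ? [].
  by apply: cont_in_snd; exact: cont_in_id.
(* Second stage: the homotopy of the merging of [S], run for a time scaled by [kap']. *)
have hom2 : hom_in R D2 (point, point) point g1 (fun zy : Y * Y => H' (1, zy)).
  exists H'; split => //.
  - pose B2 := [set p : R * (Y * Y) | height p.2.1 <= 3 / 4] `&`
               [set p | height (y1 1 p.2) <= 15 / 16].
    apply: (glue_in (A := [set p : R * (Y * Y) | kap' p.2 = 0]) (B := B2)).
    + move=> [t zy] _; case: (eqVneq (kap' zy) 0) => [|/kap'B]; [by left|by right].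
    + by apply: closed_in_eq => //; [exact: TD2|exact: cont_in_cst].
    + apply: closed_inI; apply: closed_in_le; try exact: cont_in_cst.
        exact: (TD2 _ (fun zy => height zy.1)).
      exact: (TD2 _ (fun zy => height (y1 1 zy))).
    + apply: (cont_in_eq (f := fun p : R * (Y * Y) => g1 p.2)).
        by move=> p [_ /= k0]; rewrite /H' k0 eqxx.
      by apply: cont_in_sub (TD2 _ _ g1_cont) => ? [].
    + apply: (cont_in_eq (f := fun p : R * (Y * Y) =>
          H (p.1 * kap' p.2, (rpush (1, p.2.1), g1 p.2)))).
        move=> [t zy] [[_ /= Dzy] Bzy]; rewrite /H' /=; case: eqP => // ->.
        by rewrite mulr0 H0//; exact: BS.
      apply: (cont_in_comp cH); last first.
        by move=> [t zy] [[_ /= Dzy] Bzy]; split => //; exact: BS.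
      apply: cont_in_pair; last first.
        by apply: cont_in_sub (TD2 _ _ crp) => ? [].
      apply: cont_inM; first by apply: cont_in_fst; exact: cont_in_id.
      by apply: cont_in_sub (TD2 _ _ ckap') => ? [].
  - move=> zy Dzy; rewrite /H' /=; case: eqVneq => // /kap'B Bzy.
    by rewrite mul0r H0//; exact: BS.
  - move=> t; rewrite /H' /= /g1 y1p rpushS//.
    by case: eqP.
(* The weights [c3] and [1 - c3] add up to 1. The first is nonzero only for heights above 3/8, where
   [kap] is 1 near the diagonal, the second only for heights below 5/8, where [kap'] is 1 near the
   diagonal. *)
pose c3 (zy : Y * Y) := clamp (4 * height zy.1 - 3 / 2).
pose w4 (zy : Y * Y) := (1 - c3 zy) * clamp (1 - 16 * gap zy).
pose u' (zy : Y * Y) := c3 zy * clamp (1 - 16 * dist zy) +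
  (if w4 zy == 0 then 0 else w4 zy * u (rpush (1, zy.1), g1 zy)).
have c3P zy : c3 zy != 0 -> 3 / 8 < height zy.1 by move=> /clamp_neq0; lra.
have c3P' zy : c3 zy != 1 -> height zy.1 < 5 / 8 by move=> /clamp_neq1; lra.
have w4P zy : w4 zy != 0 -> height zy.1 < 5 / 8 /\ gap zy < 1 / 16.
  rewrite mulf_eq0 negb_or subr_eq0 eq_sym => /andP[/c3P' h1 /clamp_neq0 h2].
  by split => //; lra.
have cc3 : cont_in D2 c3 by apply: cont_in_clamp; exact: affine_cont.
have cw4 : cont_in D2 w4.
  apply: cont_inM; first by apply: cont_inB => //; exact: cont_in_cst.
  by apply: cont_in_clamp; exact: affine_cont'.
exists (fun zy : Y * Y => H' (1, zy)), u'; split.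
- exact: hom_in_trans hom1 hom2.
- apply: cont_inD.
    by apply: cont_inM => //; apply: cont_in_clamp; apply: affine_cont'; exact: dist_cont.
  apply: (glue_in (A := [set zy | w4 zy = 0]) (B := B)) => //.
  + move=> zy _; case: (eqVneq (w4 zy) 0) => [|/w4P[h1 h2]]; first by left.
    by right; apply: BP; lra.
  + by apply: closed_in_eq => //; exact: cont_in_cst.
  + apply: (cont_in_eq (f := fun=> 0 : R)); last exact: cont_in_cst.
    by move=> zy [_ /= ->]; rewrite eqxx.
  + apply: (cont_in_eq (f := fun zy => w4 zy * u (rpush (1, zy.1), g1 zy))).
      by move=> zy _; case: eqP => // ->; rewrite mul0r.
    apply: cont_inM; first by apply: cont_in_sub cw4 => ? [].
    apply: (cont_in_comp cu); last by move=> zy [Dzy Bzy]; exact: BS.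
    by apply: cont_in_sub crp => ? [].
- move=> z Sz; have Dz : D2 (z, z) by [].
  rewrite /u' dist_diag mulr0 subr0 (@clamp_eq1 _ 1)// mulr1.
  have -> : w4 (z, z) = 1 - c3 (z, z) by rewrite /w4 gap_diag mulr0 subr0 clamp_eq1// mulr1.
  case: eqP => [/eqP|/eqP]; first by rewrite subr_eq0 addr0 => /eqP.
  rewrite subr_eq0 eq_sym => /c3P' h1.
  have Bz : B (z, z) by apply: BP => //=; [lra|rewrite gap_diag; lra].
  have := BS _ Dz Bz; rewrite /g1 y1_diag => -[/= Sr _].
  by rewrite u1// mulr1 addrC subrK.
move=> z y Sz Sy; have Dzy : D2 (z, y) by [].
have Dz : D2 (z, z) by [].
case: (eqVneq (c3 (z, y) * clamp (1 - 16 * dist (z, y))) 0) => [e0|].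
  rewrite /u' e0 add0r.
  case: (eqVneq (w4 (z, y)) 0) => [_|/w4P[/= h1 h2]]; first by rewrite eqxx.
  rewrite mulf_eq0 negb_or => /andP[_ un0].
  have Bzy : B (z, y) by apply: BP => //=; lra.
  have Bz : B (z, z) by apply: BP => //=; [lra|rewrite gap_diag; lra].
  have k1 : kap' (z, y) = 1 by rewrite /kap' !clamp_eq1 ?mulr1//=; lra.
  have k1' : kap' (z, z) = 1 by rewrite /kap' !clamp_eq1 ?mulr1//= ?gap_diag; lra.
  have SS := BS _ Dzy Bzy; have SS' := BS _ Dz Bz.
  rewrite /H' /= k1 k1' oner_eq0 mulr1 !H1//.
  rewrite uPsi//; [|by case: SS|by case: SS].
  by rewrite /g1 y1_diag.
(* Here [kap] is 1, so [y] has become [z] after the first stage and the second stage cannot tell the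
   two pairs apart. *)
rewrite mulf_eq0 negb_or => /andP[/c3P /= h1 /clamp_neq0 h2] _.
have k1 : kap (z, y) = 1 by rewrite /kap !clamp_eq1 ?mulr1//=; lra.
have yz : y1 1 (z, y) = z by rewrite y1_near.
by rewrite /H' /kap' /gap /g1 /= yz y1_diag.
Qed.

End attach_cell.

(** * Finite subcomplexes *)

Section subcomplexes.
Variables (R : realType) (Y : ptopologicalType) (K : cw_structure R Y).

Let open_cell (e : cell K) := char_map K e @` open_disc R (cell_dim e).

Let open_cell_inj e e' y : open_cell e y -> open_cell e' y -> e = e'.
Proof.
move=> ey e'y; apply: (cells_disjoint (c := K)) => //; exists y; split => //.
Qed.

(** The merging is built in so that it is carried along as cells are attached. The last clause makes
    [S] a union of open cells. *)
Definition subcomplex (S : set Y) :=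
  [/\ compact S, S point, merging R S &
      forall e, open_cell e `<=` S \/ open_cell e `&` S = set0].

Lemma subcomplex_attach S (e : cell K) : subcomplex S ->
  char_map K e @` unit_sphere R (cell_dim e) `<=` S ->
  exists S', [/\ subcomplex S', S `<=` S' & open_cell e `<=` S'].
Proof.
move=> [cS Sp mS Scell] eS.
have [eS'|e0] := Scell e; first by exists S; split.
exists (S `|` open_cell e); split; last 2 first.
- by left.
- by right.
have hY := cw_hausdorff K.
have cc : cont_in (closed_disc R (cell_dim e)) (char_map K e).
  exact/cont_inP/(@char_map_continuous _ _ K e).
have disj v : open_disc R (cell_dim e) v -> ~ S (char_map K e v).
  move=> Dv Sv; suff : (open_cell e `&` S) (char_map K e v) by rewrite e0.
  by split => //; exists v.
split.
- exact: attach_compact.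
- by left.
- by apply: merging_attach => //; exact: char_map_inj.
move=> e'; have [e'S|e'0] := Scell e'; first by left => y /e'S; left.
have [->|ne] := pselect (e' = e); first by left => y; right.
right; apply/seteqP; split => // y [e'y [Sy|ey]].
  by suff : (open_cell e' `&` S) y by rewrite e'0.
by apply: ne; exact: open_cell_inj e'y ey.
Qed.

Lemma subcomplex_seq (s : seq (cell K)) S :
  (forall e, List.In e s -> forall S, subcomplex S ->
     exists S', [/\ subcomplex S', S `<=` S' & open_cell e `<=` S']) ->
  subcomplex S ->
  exists S', [/\ subcomplex S', S `<=` S' &
    forall e, List.In e s -> open_cell e `<=` S'].
Proof.
elim: s S => [|e s IH] S H sS; first by exists S; split.
have [|S1 [sS1 SS1 eS1]] := H e _ S sS; first by left.
have [|S2 [sS2 S12 H2]] := IH S1 _ sS1; first by move=> e' ?; apply: H; right.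
exists S2; split => //; first exact: subset_trans SS1 S12.
by move=> e' [<-|/H2//]; exact: subset_trans eS1 S12.
Qed.

(** Cells form a bare [Type], hence [List.In] and the detour through [{classic T}]. *)
Lemma finite_set_In (T : Type) (F : set T) : finite_set F ->
  exists s : seq T, forall x, F x -> List.In x s.
Proof.
move=> /(@finite_seqP {classic T})[s Fs]; exists s => x; rewrite Fs /=.
elim: s {Fs} => [//|y s IH]; rewrite inE => /orP[/eqP->|/IH]; first by left.
by right.
Qed.

(** Induction on the dimension: by closure finiteness, the boundary of the cell lies in finitely
    many cells of lower dimension, which are attached first. *)
Lemma subcomplex_cell (e : cell K) S : subcomplex S ->
  exists S', [/\ subcomplex S', S `<=` S' & open_cell e `<=` S'].
Proof.
have [n] := ubnP (cell_dim e); elim: n e S => // n IH e S en sS.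
have [F [/finite_set_In[s Fs] Fdim FS]] := closure_finite e.
(* The list [s] may contain more than [F]; filtering restores the bound on dimensions that the
   induction needs. *)
pose s' := [seq c <- s | (cell_dim c < cell_dim e)%N].
have [|S1 [sS1 SS1 H1]] := @subcomplex_seq s' S _ sS.
  move=> c cs S2 sS2; apply: IH => //.
  have cd : (cell_dim c < cell_dim e)%N.
    by move: cs; rewrite /s'; elim: (s) => //= d t IHt; case: ifP => // ? [<-|/IHt].
  by apply: leq_trans cd _; rewrite -ltnS.
have [|S2 [sS2 S12 H2]] := @subcomplex_attach S1 e sS1; last first.
  by exists S2; split => //; exact: subset_trans SS1 S12.
apply: subset_trans FS _ => y [c Fc cy]; apply: (H1 c) => //.
have /Fs := Fc; have := Fdim _ Fc; rewrite /s' => cd.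
by elim: (s) => //= d t IHt [->|/IHt]; [rewrite cd; left|case: ifP; [right|]].
Qed.

(** Otherwise there is an injective sequence in [A] with its points in distinct cells. All its tails
    are closed in the weak topology, so a cluster point would lie in every tail, which injectivity
    forbids. *)
Lemma compact_finite_cells (A : set Y) : compact A ->
  finite_set [set e | exists2 y, A y & open_cell e y].
Proof.
move=> cA; set E := [set e | _]; apply: contrapT => infE.
have [pt ptP] : {pt : cell K -> Y &
    forall e, E e -> A (pt e) /\ open_cell e (pt e)}.
  apply: (@choice _ _ (fun e y => E e -> A y /\ open_cell e y)) => e.
  have [[y Ay ey]|ne] := pselect (E e); first by exists y.
  by exists point.
have [cellof cellofP] : {cellof : Y -> cell K & forall y, open_cell (cellof y) y}.
  apply: (@choice _ _ (fun y e => open_cell e y)) => y.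
  have : [set: Y] y by [].
  by rewrite -(cells_cover K) => -[e _ ey]; exists e.
have ptK e : E e -> cellof (pt e) = e.
  by move=> /ptP[_ ey]; exact: open_cell_inj (cellofP _) ey.
have /infiniteP/pcard_leP[g] : infinite_set (pt @` E).
  move=> /(finite_image cellof) fin; apply: infE; apply: sub_finite_set fin.
  by move=> e Ee; exists (pt e); [exists e|exact: ptK].
have gE k : (pt @` E) (g k) by exact: funS.
have g_inj : injective g by move=> k l kl; apply: (inj (f := g)) => //; rewrite inE.
have gA k : A (g k) by have [e Ee <-] := gE k; case: (ptP e Ee).
have gpt k : g k = pt (cellof (g k)) by have [e Ee <-] := gE k; rewrite ptK.
pose tail m := [set g k | k in [set k | (m <= k)%N]].
have tail_closed m : closed (tail m).
  apply: (weak_closed (c := K)) => e.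
  (* A closed cell meets only finitely many open cells, each containing at most one point of the
     sequence, and finite sets are closed. *)
  have [F [finF _ FS]] := closure_finite e.
  have acc := accessible_finite_set_closed.1 (hausdorff_accessible (cw_hausdorff K)).
  apply: acc; apply: (@sub_finite_set _ _ (pt @` (F `|` [set e]))).
    move=> _ [[k _ <-] [v Dv vk]]; rewrite gpt; exists (cellof (g k)) => //.
    have [Dv'|Sv] := closed_disc_cases Dv.
      by right; apply: open_cell_inj (cellofP _) _; exists v.
    have [|c Fc ck] := FS (g k); first by exists v.
    by left; rewrite (open_cell_inj (cellofP (g k)) ck).
  by apply: finite_image; rewrite finite_setU; split => //; exact: finite_set1.
have [|x [_ xcl]] := cA (g @ \oo) _.
  by exists 0%N => // k _ /=; exact: gA.
have tailx m : tail m x.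
  apply: (tail_closed m); move: xcl; rewrite clusterE; apply.
  by exists m => // k /= mk; exists k.
have [k _ kx] := tailx 0%N; have [l /= kl lx] := tailx k.+1.
by have := g_inj k l; rewrite kx lx => /(_ erefl) E'; move: kl; rewrite E' ltnn.
Qed.

Lemma subcomplex_compact (A S : set Y) : compact A -> subcomplex S ->
  exists S', [/\ subcomplex S', S `<=` S' & A `<=` S'].
Proof.
move=> /compact_finite_cells/finite_set_In[s sP] sS.
have [|S' [sS' SS' H]] := @subcomplex_seq s S _ sS.
  by move=> e _ S1 sS1; exact: subcomplex_cell.
exists S'; split => // y Ay; have : [set: Y] y by [].
rewrite -(cells_cover K) => -[e _ ey]; apply: (H e) => //.
by apply: sP; exists y.
Qed.

Lemma subcomplex_point (e : cell K) : cell_dim e = 0%N -> open_cell e point ->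
  subcomplex [set point].
Proof.
move=> e0 ep; have [v Dv vp] := ep.
have ept y : open_cell e y -> y = point.
  move=> [w Dw <-]; rewrite -vp; congr (char_map K e _).
  by apply/rowP => i; have := ltn_ord i; rewrite {2}e0.
split.
- exact: compact_set1.
- by [].
- exists (fun=> point), (fun=> 1); split.
  + exists (fun=> point); split => //; first exact: cont_in_cst.
    by move=> [z y] [/= _ ->].
  + exact: cont_in_cst.
  + by [].
  + by [].
move=> e'; have [e'p|ne'p] := pselect (open_cell e' point).
  by left => y; rewrite (open_cell_inj e'p ep) => /ept.
by right; apply/seteqP; split => // y [e'y /= yp]; apply: ne'p; rewrite -yp.
Qed.

End subcomplexes.

(** * Ensembles as functionals *)

Section ensembles.
Variables (X Y : ptopologicalType).
Implicit Types (P Q : (X -> Y) -> Prop) (F G : (X -> Y) -> int).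
Implicit Types (L : ((X -> Y) -> int) -> int) (T : seq X).

(* An ensemble is encoded by the functional that extends integer-valued
   functions on [Y^X] linearly. *)
Inductive span P : (((X -> Y) -> int) -> int) -> Prop :=
| span_nil L : (forall F, L F = 0) -> span P L
| span_cons u f L L' : P f -> span P L ->
    (forall F, L' F = u * F f + L F) -> span P L'.

Lemma span_eq P L L' : (forall F, L F = L' F) -> span P L -> span P L'.
Proof.
move=> LL' sL; case: sL LL' => [L0 H|u f L1 L2 Pf sL H] LL'.
  by apply: span_nil => F; rewrite -LL'.
by apply: (span_cons Pf sL) => F; rewrite -LL' H.
Qed.

Lemma span_sub P Q L : (forall f, P f -> Q f) -> span P L -> span Q L.
Proof.
move=> PQ; elim=> [L0 H|u f L0 L1 Pf _ IH H]; first exact: span_nil.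
exact: span_cons (PQ _ Pf) IH H.
Qed.

Lemma span_pt P f : P f -> span P (fun F => F f).
Proof.
move=> Pf; apply: (span_cons (L := fun=> 0) (u := 1) Pf).
  exact: span_nil.
by move=> F; rewrite mul1r addr0.
Qed.

Lemma spanD P L L' : span P L -> span P L' -> span P (fun F => L F + L' F).
Proof.
move=> + sL'; elim=> [L0 H|u f L0 L1 Pf _ IH H].
  by apply: span_eq sL' => F; rewrite H add0r.
by apply: (span_cons (u := u) Pf IH) => F; rewrite H addrA.
Qed.

Lemma spanZ P k L : span P L -> span P (fun F => k * L F).
Proof.
elim=> [L0 H|u f L0 L1 Pf _ IH H].
  by apply: span_nil => F; rewrite H mulr0.
by apply: (span_cons (u := k * u) Pf IH) => F; rewrite H mulrDr mulrA.
Qed.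

Lemma spanB P L L' : span P L -> span P L' -> span P (fun F => L F - L' F).
Proof.
move=> sL sL'; apply: (spanD sL); apply: span_eq (spanZ (-1) sL') => F.
by rewrite mulN1r.
Qed.

Lemma span_sum P (I : finType) (A : pred I) (M : I -> ((X -> Y) -> int) -> int) :
  (forall i, A i -> span P (M i)) -> span P (fun F => \sum_(i | A i) M i F).
Proof.
move=> H.
suff sH (s : seq I) : span P (fun F => \sum_(i <- s | A i) M i F) by exact: sH.
elim: s => [|i s IH]; first by apply: span_nil => F; rewrite big_nil.
case Ai : (A i).
  by apply: span_eq (spanD (H i Ai) IH) => F; rewrite big_cons Ai.
by apply: span_eq IH => F; rewrite big_cons Ai.
Qed.

(** This is the push-forward of an ensemble along [op], seen on test functions. *)
Lemma span_comp P Q (op : (X -> Y) -> X -> Y) L :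
  (forall f, P f -> Q (op f)) -> span P L -> span Q (fun F => L (F \o op)).
Proof.
move=> PQ; elim=> [L0 H|u f L0 L1 Pf _ IH H]; first exact: span_nil.
exact: span_cons (PQ _ Pf) IH _.
Qed.

Lemma span_ext P L F G : span P L -> (forall f, P f -> F f = G f) -> L F = L G.
Proof.
move=> sL FG; elim: sL => [L0 H|u f L0 L1 Pf _ IH H]; first by rewrite !H.
by rewrite !H IH FG.
Qed.

Lemma span_addf P L F G : span P L -> L (fun f => F f + G f) = L F + L G.
Proof.
elim=> [L0 H|u f L0 L1 Pf _ IH H]; first by rewrite !H addr0.
by rewrite !H IH mulrDr addrACA.
Qed.

Lemma span_scalef P L k F : span P L -> L (fun f => k * F f) = k * L F.
Proof.
elim=> [L0 H|u f L0 L1 Pf _ IH H]; first by rewrite !H mulr0.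
by rewrite !H IH mulrDr mulrCA.
Qed.

Lemma span_subf P L F G : span P L -> L (fun f => F f - G f) = L F - L G.
Proof.
move=> sL; rewrite (_ : (fun f => _) = fun f => F f + -1 * G f).
  by rewrite (span_addf _ _ sL) (span_scalef _ _ sL) mulN1r.
by apply/funext => f; rewrite mulN1r.
Qed.

Lemma span_sumf P L (I : finType) (A : pred I) (F : I -> (X -> Y) -> int) :
  span P L -> L (fun f => \sum_(i | A i) F i f) = \sum_(i | A i) L (F i).
Proof.
elim=> [L0 H|u f L0 L1 Pf _ IH H].
  by rewrite !H big1// => i _; rewrite H.
rewrite H IH mulr_sumr -big_split/=.
by apply: eq_bigr => i _; rewrite H.
Qed.

Lemma span_family P L : span P L -> exists n (u : 'I_n -> int) (f : 'I_n -> X -> Y),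
  (forall i, P (f i)) /\ forall F, L F = \sum_(i < n) u i * F (f i).
Proof.
elim=> [L0 H|u f L0 L1 Pf _ [n [v [g [Pg Lg]]]] H].
  exists 0%N, (fun=> 0), (fun=> fun=> point); split; first by case.
  by move=> F; rewrite big_ord0.
exists n.+1, (fun i => if unlift ord0 i is Some j then v j else u),
  (fun i => if unlift ord0 i is Some j then g j else f); split.
  by move=> i; case: unliftP.
move=> F; rewrite H Lg big_ord_recl unlift_none; congr (_ + _).
by apply: eq_bigr => i _; rewrite liftK.
Qed.

Definition local_on (Z : set X) F :=
  forall f g, (forall x, Z x -> f x = g x) -> F f = F g.

(** The dual form of being r-equal to a single map: instead of restricting to a finite set, one
    tests against the functions that see only the values there. *)
Definition represents (r : nat) L (c : X -> Y) := forall T F,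
  (size T <= r)%N -> local_on [set x | x \in T] F -> L F = F c.

End ensembles.

(** * Symmetry for ensembles agreeing on neighbourhoods *)

Lemma bump_cover (R : realType) (X : ptopologicalType) (N : X -> set X) :
  hausdorff_space X -> compact [set: X] ->
  (forall x, open (N x)) -> (forall x, N x x) ->
  exists (z : X -> X -> R) (ps : seq X),
  [/\ forall p, continuous (z p), forall p x, z p x < 2 -> N p x &
      forall x, exists2 p, p \in ps & z p x <= -1].
Proof.
move=> hX cX oN Nx.
have crX : completely_regular_space X.
  apply: (@normal_completely_regular R); first exact: compact_normal.
  exact: hausdorff_accessible.
pose f p : X -> R := Urysohn [set p] (~` N p).
have sepf p : uniform_separator [set p] (~` N p).
  by apply: crX; [exact: open_closedC|exact].
have f0 p : f p p = 0.
  by have := Urysohn_sub0 (sepf p) (R := R); apply; exists p.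
have f1 p x : ~ N p x -> f p x = 1.
  by move=> nNx; have := Urysohn_sub1 (sepf p) (R := R); apply; exists x.
(* So [z p] is -2 at [p] and 2 off [N p], with room for the intermediate levels 0 and -1. *)
pose z p x := 4 * f p x - 2.
have cz p : continuous (z p).
  apply/cont_inT; apply: cont_inB; last exact: cont_in_cst.
  apply: cont_inM; first exact: cont_in_cst.
  by apply/cont_inT; exact: Urysohn_continuous.
have [D _ Dcov] : finite_subset_cover [set: X] (fun p => [set x | z p x < -1]) [set: X].
  have := cX; rewrite compact_cover; apply.
    move=> p _; rewrite (_ : [set x | _] = z p @^-1` [set t | t < -1])//.
    apply: open_comp; last exact: open_lt.
    by move=> x _; exact: cz.
  by move=> x _; exists x => //=; rewrite /z f0; lra.
exists z, (finmap.enum_fset D); split => //.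
  by move=> p x; rewrite /z => zx; apply: contrapT => /f1 fx; move: zx; rewrite fx; lra.
move=> x; have [p Dp /ltW zx] := Dcov x I.
by exists p.
Qed.

Section symmetry.
Variables (R : realType) (X Y : ptopologicalType).
Hypotheses (hX : hausdorff_space X) (cX : compact [set: X]) (hY : hausdorff_space Y).
Variables (n : nat) (u : 'I_n -> int) (a : 'I_n -> X -> Y) (b a0 : X -> Y).
Variables (r : nat) (N : X -> set X).
Hypotheses (ha : forall i, hom R a0 (a i)) (hb : based_cont b).
Hypotheses (oN : forall x, open (N x)) (Nx : forall x, N x x).

Let U (K : seq X) := [set y | exists2 x, x \in K & N x y].

Hypothesis good : forall K F, (size K <= r)%N -> local_on (U K) F ->
  \sum_(i < n) u i * F (a i) = F b.

Section agreeing.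
Variables (s : nat) (K : seq X).
Hypothesis sK : (size K + s <= r)%N.

Let J i := `[< forall x, U K x -> a i x = b x >].

(** The function [F] is multiplied by the indicator of agreement with [b] on [U K]. The product is
    local on the neighbourhood of [K ++ T], which has at most [r] points, so [good] applies. *)
Lemma agreeing_sum (T : seq X) F : (size T <= s)%N ->
  local_on [set x | x \in T] F -> \sum_(i < n | J i) u i * F (a i) = F b.
Proof.
move=> sT lF.
pose F' (f : X -> Y) := if `[< forall x, U K x -> f x = b x >] then F f else 0.
have := good (K := K ++ T) (F := F'); rewrite size_cat => /(_ _ _)H.
have {H} : \sum_(i < n) u i * F' (a i) = F' b.
  apply: H; first by apply: leq_trans sK; rewrite leq_add2l.
  move=> f g fg; rewrite /F'.
  have -> : F f = F g.
    by apply: lF => x xT; apply: fg; exists x => //; rewrite mem_cat xT orbT.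
  suff -> : `[< forall x, U K x -> f x = b x >] = `[< forall x, U K x -> g x = b x >] by [].
  have fgK x : U K x -> f x = g x.
    by move=> [p pK px]; apply: fg; exists p => //; rewrite mem_cat pK.
  by apply: asbool_equiv_eq; split=> H x Ux; rewrite -H// fgK.
rewrite /F' asboolT// => <-; rewrite [LHS]big_mkcond/=; apply: eq_bigr => i _.
by rewrite /J; case: ifP => // _; rewrite mulr0.
Qed.

Lemma agreeing_sum1 : \sum_(i < n | J i) u i = 1.
Proof.
rewrite -(@agreeing_sum [::] (fun=> 1))//.
by apply: eq_bigr => i _; rewrite mulr1.
Qed.

Lemma agreeing_ex : exists i, J i.
Proof.
apply: contrapT => nJ; have := agreeing_sum1; rewrite big1// => i Ji.
by case: nJ; exists i.
Qed.

End agreeing.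

Let PP (Z : set X) (c f : X -> Y) := hom R b f /\ forall x, Z x -> f x = c x.

(* The ensemble may be prescribed near [r - s] points if it only has to agree
   with [c] on [s] points; this trade-off makes the induction on [s] work. *)
Definition deformable_rel (s : nat) := forall (K : seq X) (w : X -> R) (c : X -> Y),
  (size K + s <= r)%N ->
  continuous w -> (forall x, w x < 2 -> U K x) -> hom R a0 c ->
  exists2 L, span (PP [set x | w x <= 0] c) L & represents s L c.

(** Some [a i0] agrees with [b] on [U K] and is homotopic to [c]. Its homotopy to [c], run for the
    time [clamp (2 - w)], moves [b] and all agreeing [a i] at once, since they coincide wherever
    this time is nonzero. *)
Lemma agreeing_start s (K : seq X) (w : X -> R) (c : X -> Y) :
  (size K + s <= r)%N -> continuous w ->
  (forall x, w x < 2 -> U K x) -> hom R a0 c ->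
  exists op : (X -> Y) -> X -> Y,
  [/\ forall f g x, f x = g x -> op f x = op g x,
      forall f x, w x <= 1 -> op f x = c x, hom R b (op b) &
      forall i, (forall x, U K x -> a i x = b x) -> hom R a0 (op (a i))].
Proof.
move=> sK cw wU hc; have [i0 /asboolP Ji0] := agreeing_ex sK.
have /homP[G [cG G0 G1 Gp]] : hom R (a i0) c by apply: hom_trans hc; exact/hom_sym.
pose t x := clamp (2 - w x).
have ct : continuous t.
  apply/cont_inT/cont_in_clamp; apply: cont_inB; first exact: cont_in_cst.
  exact/cont_inT.
have tU x : t x != 0 -> U K x by move=> /clamp_neq0 tx; apply: wU; lra.
exists (move_along G t); split.
- by move=> f g x fg; rewrite /move_along fg.
- move=> f x wx; rewrite /move_along /t clamp_eq1; last by lra.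
  by rewrite oner_eq0 G1.
- by apply: move_along_hom => // x /tU Ux; rewrite G0 Ji0.
- move=> i Ji; apply: hom_trans (ha i) _; apply: move_along_hom => //.
    exact: hom_based_cont (ha i).
  by move=> x /tU Ux; rewrite G0 Ji0// Ji.
Qed.

(** A function local on the empty set is constant, so a single map suffices. *)
Lemma deformable_rel0 : deformable_rel 0.
Proof.
move=> K w c sK cw wU hc; have [op [_ op1 hop _]] := agreeing_start sK cw wU hc.
exists (fun F => F (op b)).
  by apply: span_pt; split => // x /= wx; apply: op1; apply: le_trans wx _.
by move=> [|//] F _ lF; apply: lF.
Qed.

(** * The induction step: small pieces, collars and twists *)

Section induction_step.
Variables (s : nat) (IH : deformable_rel s).
Variables (K : seq X) (w : X -> R) (c : X -> Y).
Hypotheses (sK : (size K + s.+1 <= r)%N) (cw : continuous w).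
Hypothesis wU : forall x, w x < 2 -> U K x.

Let J i := `[< forall x, U K x -> a i x = b x >].

(* The maps [h i], [i] in [J], start at a common deformation of the [a i] and
   end at [c]; on [w <= 1] they are loops at [c]. *)
Variables (b' : X -> Y) (h : 'I_n -> R * X -> Y).
Hypotheses (hb' : hom R b b') (b'c : forall x, w x <= 1 -> b' x = c x).
Hypotheses (h_cont : forall i, J i -> continuous (h i)).
Hypotheses (h_point : forall i t, J i -> h i (t, point) = point).
Hypotheses (h_start : forall i, J i -> hom R a0 (fun x => h i (0, x))).
Hypotheses (h_loop : forall i x, J i -> w x <= 1 -> h i (0, x) = c x).
Hypotheses (h_end : forall i x, J i -> h i (1, x) = c x).
Hypotheses (h_sum : forall T F, (size T <= s.+1)%N ->
  local_on [set x | x \in T] F ->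
  \sum_(i < n | J i) u i * F (fun x => h i (0, x)) = F b').

Let m := s.+2.

(* The collars [k < m w < k + 1] are disjoint, so a set of [s + 1] points
   misses one of the [m] of them. *)
Let collar (k : nat) (x : X) : R := clamp (m%:R * w x - k%:R).

Let collar_cont k : continuous (collar k).
Proof.
apply/cont_inT/cont_in_clamp; apply: cont_inB; last exact: cont_in_cst.
by apply: cont_inM; [exact: cont_in_cst|exact/cont_inT].
Qed.

Let m_gt0 : 0 < m%:R :> R. Proof. by rewrite ltr0n. Qed.

Let collar0 k x : m%:R * w x <= k%:R -> collar k x = 0.
Proof. by move=> H; apply: clamp_eq0; lra. Qed.

Let collar1 k x : collar k x != 1 -> m%:R * w x < k.+1%:R.
Proof. by move=> /clamp_neq1; rewrite -natr1; lra. Qed.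

Let inner k x : (k < m)%N -> m%:R * w x <= k.+1%:R -> w x <= 1.
Proof.
move=> km H; rewrite -(ler_pM2l m_gt0) mulr1; apply: le_trans H _.
by rewrite ler_nat.
Qed.

Let inner' k x : (k < m)%N -> m%:R * w x <= k%:R -> w x <= 1.
Proof. by move=> km H; apply: (inner km); apply: le_trans H _; rewrite ler_nat. Qed.

Let path_at i (t : X -> R) : X -> Y := fun x => h i (t x, x).

Let path_at_hom i t : J i -> continuous t -> hom R a0 (path_at i t).
Proof.
move=> Ji ct; apply: hom_trans (h_start Ji) _.
have -> : path_at i t = move_along (h i) t (fun x => h i (0, x)).
  by apply/funext => x; rewrite /path_at /move_along; case: eqP => // ->.
apply: move_along_hom => //; [exact: hom_based_cont (h_start Ji)|exact: h_cont|].
by move=> t'; exact: h_point.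
Qed.

Section one_collar.
Variables (k : nat) (km : (k < m)%N).
Let Z := [set x | m%:R * w x <= k%:R].

(** The hypothesis [IH], with [p] added to [K], gives maps that equal [path_at i t] wherever [t] and
    [t'] differ. Moving them from [t] to [t'] and subtracting gains one test point: at a point where
    the times differ the values are already known, leaving [s] points to be tested. *)
Lemma move_one_piece i (t t' z : X -> R) p : J i -> continuous t -> continuous t' ->
  continuous z -> (forall x, z x < 2 -> N p x) ->
  (forall x, Z x -> t x = 0) -> (forall x, Z x -> t' x = 0) ->
  (forall x, t' x != t x -> z x <= 0) ->
  exists2 L, span (PP Z c) L & forall T F, (size T <= s.+1)%N ->
    local_on [set x | x \in T] F ->
    L F = F (path_at i t') - F (path_at i t).
Proof.
move=> Ji ct ct' cz zN Zt Zt' tz.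
(* The slope is chosen so that [w1] is 0 where [m%:R * w] is [k], and 2 where [w] is 2. *)
pose q : R := 2 / (2 * m%:R - k%:R).
have km' : k%:R < m%:R :> R by rewrite ltr_nat.
have q0 : 0 < q by rewrite divr_gt0//; have := m_gt0; lra.
pose w1 x := (m%:R * w x - k%:R) * q.
have w12 x : w1 x < 2 -> w x < 2.
  rewrite /w1 /q mulrCA gtr_pMr// ltr_pdivrMr ?mul1r; last by have := m_gt0; lra.
  by rewrite ltrBlDr subrK mulrC ltr_pM2r.
have w10 x : Z x -> w1 x <= 0.
  by move=> Zx; rewrite /w1 pmulr_lle0// subr_le0.
pose w' x := Num.min (w1 x) (z x).
have [|||L sL Lc] := IH (K := p :: K) (w := w') _ _ _ (path_at_hom Ji ct).
- by rewrite /= addSnnS.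
- apply/cont_inT/cont_in_min; last exact/cont_inT.
  apply: cont_inM; last exact: cont_in_cst.
  apply: cont_inB; last exact: cont_in_cst.
  by apply: cont_inM; [exact: cont_in_cst|exact/cont_inT].
- move=> x; rewrite /w' gt_min => /orP[/w12/wU[y yK Ny]|/zN Np].
    by exists y => //; rewrite inE yK orbT.
  by exists p => //; rewrite inE eqxx.
pose d x := t' x - t x.
pose Q (tx : R * X) := h i (t tx.2 + tx.1, tx.2).
pose op := move_along Q d.
have cQ : continuous Q.
  apply/cont_inT.
  apply: (cont_in_comp (D := setT) (g := h i)
    (f := fun tx : R * X => (t tx.2 + tx.1, tx.2))) => //.
    by apply/cont_inT; exact: h_cont.
  apply: cont_in_pair; last by apply: cont_in_snd; exact: cont_in_id.
  apply: cont_inD; last by apply: cont_in_fst; exact: cont_in_id.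
  apply: (cont_in_comp (D := setT) (g := t)) => //; first exact/cont_inT.
  by apply: cont_in_snd; exact: cont_in_id.
have cd : continuous d by apply/cont_inT/cont_inB; exact/cont_inT.
have dz x : d x != 0 -> w' x <= 0.
  by rewrite subr_eq0 => /tz zx; rewrite /w' ge_min zx orbT.
pose P := PP [set x | w' x <= 0] (path_at i t).
have hop f : P f -> hom R b (op f).
  move=> [hf fc]; apply: (hom_trans (hf)); apply: move_along_hom => //.
  - exact: hom_based_cont hf.
  - by move=> t0; exact: h_point.
  - by move=> x /dz wx; rewrite fc// /Q /= addr0.
have Zw' x : Z x -> w' x <= 0 by move=> Zx; rewrite /w' ge_min w10.
have Zc x : Z x -> path_at i t x = c x.
  by move=> Zx; rewrite /path_at Zt// h_loop//; exact: inner' Zx.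
exists (fun F => L (F \o op) - L F).
  apply: spanB; last first.
    by apply: span_sub sL => f [hf fc]; split => // x Zx; rewrite fc ?Zc//; exact: Zw'.
  apply: span_comp sL => f Pf; split; first exact: hop.
  move=> x Zx; rewrite /op /move_along /d Zt// Zt'// subrr eqxx.
  by case: Pf => _ ->; [exact: Zc|exact: Zw'].
move=> T F sT lF.
have opE : op (path_at i t) = path_at i t'.
  apply/funext => x; rewrite /op /move_along /d /Q /path_at /=; case: eqP => [/eqP|_].
    by rewrite subr_eq0 => /eqP ->.
  by rewrite addrC subrK.
rewrite -(span_subf _ _ sL) -opE.
pose F' f := F (op f) - F f.
change (L F' = F' (path_at i t)).
have [[t0 t0T dt0]|nT] := pselect (exists2 t0, t0 \in T & d t0 != 0); last first.
  have F'0 f : F' f = 0.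
    rewrite /F' (lF (op f) f) ?subrr// => x /= xT; rewrite /op /move_along.
    by case: eqP => // /eqP dx; case: nT; exists x.
  rewrite F'0 (span_ext (G := fun f => 0 * F f) sL) ?(span_scalef _ _ sL) ?mul0r//.
  by move=> f _; rewrite F'0 mul0r.
(* Overwriting the value at [t0] changes no map of [L], and makes the test function independent of
   that value. *)
pose fix0 (f : X -> Y) x := if x == t0 then path_at i t t0 else f x.
have fixE f : f t0 = path_at i t t0 -> fix0 f = f.
  by move=> ft0; apply/funext => x; rewrite /fix0; case: eqP => // ->.
rewrite (span_ext (G := F' \o fix0) sL); last first.
  by move=> f [_ fc] /=; rewrite fixE// fc//; exact: dz.
rewrite (Lc [seq x <- T | x != t0] (F' \o fix0)) /= ?fixE//.
  rewrite -ltnS; apply: leq_trans sT; rewrite -(count_predC (pred1 t0) T) size_filter.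
  by rewrite -[X in (X < _)%N]add0n ltn_add2r -has_count has_pred1.
move=> f g fg; have fix_eq x : x \in T -> fix0 f x = fix0 g x.
  move=> xT; rewrite /fix0; case: eqP => // /eqP xt0; apply: fg => /=.
  by rewrite mem_filter xt0.
rewrite /= /F'; congr (_ - _); apply: lF => x /= xT; last exact: fix_eq.
by rewrite /op /move_along fix_eq.
Qed.

(** The time is raised from 0 to [collar k] through the functions [t l], one element of a finite
    cover at a time. At time 0 the combination is [b'], and each increment comes from
    [move_one_piece]. *)
Lemma span_collar : exists2 L, span (PP Z c) L & forall T F,
  (size T <= s.+1)%N -> local_on [set x | x \in T] F ->
  L F = \sum_(i < n | J i) u i * F (path_at i (collar k)).
Proof.
have [z [ps [cz zN zcov]]] := bump_cover R hX cX oN Nx.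
(* Nonzero only where [z p] is negative, and 1 where it is at most -1; hence the maximum over [ps]
   is 1 everywhere. *)
pose psi p x := clamp (- z p x).
pose M := foldr (fun p (f : X -> R) x => Num.max (psi p x) (f x)) (fun=> 0).
pose t l x := Num.min (collar k x) (M l x).
have cM l : continuous (M l).
  elim: l => [|p l IHl] /=; apply/cont_inT; first exact: cont_in_cst.
  apply: cont_in_max; last exact/cont_inT.
  by apply: cont_in_clamp; apply: cont_inN; exact/cont_inT.
have ct l : continuous (t l) by apply/cont_inT/cont_in_min; exact/cont_inT.
have M0 l x : 0 <= M l x by elim: l => //= p l IHl; rewrite le_max IHl orbT.
have tZ l x : Z x -> t l x = 0 by move=> Zx; rewrite /t collar0// min_l.
suff [L sL HL] : exists2 L, span (PP Z c) L & forall T F,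
    (size T <= s.+1)%N -> local_on [set x | x \in T] F ->
    L F = \sum_(i < n | J i) u i * F (path_at i (t ps)).
  exists L => // T F sT lF; rewrite (HL _ _ sT lF).
  suff -> : t ps = collar k by [].
  apply/funext => x; rewrite /t min_l//; apply: le_trans (clamp_le1 _) _.
  have [p pps zp] := zcov x; elim: (ps) pps => //= p' l IHl.
  rewrite inE le_max => /orP[/eqP <-|/IHl ->]; last by rewrite orbT.
  by rewrite /psi clamp_eq1 ?lexx//; lra.
elim: ps {zcov} => [|p l [L sL HL]].
  exists (fun F => F b').
    by apply: span_pt; split => // x /(inner' km); exact: b'c.
  move=> T F sT lF; rewrite -(h_sum sT lF); apply: eq_bigr => i Ji.
  congr (_ * F _); apply/funext => x; rewrite /path_at.
  by rewrite /t /= min_r// clamp_ge0.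
have [E EP] : {E : 'I_n -> ((X -> Y) -> int) -> int & forall i, J i ->
    span (PP Z c) (E i) /\ forall T F, (size T <= s.+1)%N ->
    local_on [set x | x \in T] F ->
    E i F = F (path_at i (t (p :: l))) - F (path_at i (t l))}.
  apply: (@choice _ _ (fun i Ei => J i -> span (PP Z c) Ei /\ forall T F,
    (size T <= s.+1)%N -> local_on [set x | x \in T] F ->
    Ei F = F (path_at i (t (p :: l))) - F (path_at i (t l)))) => i.
  have [Ji|nJi] := pselect (J i); last by exists (fun=> 0).
  have [|Ei sEi EiP] := move_one_piece Ji (ct l) (ct (p :: l)) (cz p) (zN p)
    (tZ l) (tZ (p :: l)) _; last by exists Ei.
  move=> x tt; apply/ltW; rewrite -oppr_gt0; apply: clamp_neq0.
  apply: contra tt => /eqP psi0; rewrite /t /= /psi psi0.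
  by rewrite max_r.
exists (fun F => L F + \sum_(i < n | J i) u i * E i F).
  apply: spanD => //; apply: span_sum => i Ji; apply: spanZ.
  by case: (EP i Ji).
move=> T F sT lF; rewrite (HL _ _ sT lF) -big_split/=; apply: eq_bigr => i Ji.
by have [_ /(_ _ _ sT lF) ->] := EP i Ji; rewrite -mulrDr addrC subrK.
Qed.

End one_collar.

Let Z k := [set x | m%:R * w x <= k%:R].

(** A map equal to [c] up to the outer end of collar [k] gets the loop [h i] inserted along that
    collar. Time runs backwards because [h i] meets [c] at time 1; beyond the collar the map is
    kept. *)
Let twist k i := move_along (fun tx => h i (1 - tx.1, tx.2)) (fun x => 1 - collar k x).

Let twist_near k i x f : (k < m)%N -> J i -> m%:R * w x <= k%:R ->
  twist k i f x = c x.
Proof.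
move=> km Ji H; rewrite /twist /move_along collar0// subr0 oner_eq0 subrr h_loop//.
exact: inner' H.
Qed.

Let twist_hom k i f : (k < m)%N -> J i -> PP (Z k.+1) c f -> PP (Z k) c (twist k i f).
Proof.
move=> km Ji [hf fc]; split; last by move=> x Zx; exact: twist_near.
apply: (hom_trans hf); apply: move_along_hom => //.
- exact: hom_based_cont hf.
- apply/cont_inT; apply: (cont_in_comp (D := setT) (g := h i)
    (f := fun tx : R * X => (1 - tx.1, tx.2))) => //.
    by apply/cont_inT; exact: h_cont.
  apply: cont_in_pair; last by apply: cont_in_snd; exact: cont_in_id.
  by apply: cont_inB; [exact: cont_in_cst|apply: cont_in_fst; exact: cont_in_id].
- by move=> t; rewrite h_point.
- by apply/cont_inT/cont_inB; [exact: cont_in_cst|exact/cont_inT].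
- move=> x; rewrite subr_eq0 eq_sym => /collar1 /ltW Zx.
  by rewrite subr0 h_end// fc.
Qed.

Let twist_c k i : J i -> twist k i c = path_at i (collar k).
Proof.
move=> Ji; apply/funext => x; rewrite /twist /move_along /path_at /=.
case: eqP => [/eqP|_]; first by rewrite subr_eq0 => /eqP <-; rewrite h_end.
by rewrite subKr.
Qed.

(* [eps k] is dual to [1 - \sum_(i | J i) u i * twist k i]; the product of all
   of them kills [c] up to [s + 1] points, which inverts each sum of twists up
   to a homotopy. *)
Let eps k (G : (X -> Y) -> int) f := G f - \sum_(i < n | J i) u i * G (twist k i f).

Let local_eps T k F : local_on T F -> local_on T (eps k F).
Proof.
move=> lF f g fg; rewrite /eps (lF f g fg); congr (_ - _).
apply: eq_bigr => i _; congr (_ * _); apply: lF => x Tx.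
by rewrite /twist /move_along fg.
Qed.

Let local_iter T k F : local_on T F -> local_on T (iteri k eps F).
Proof. by move=> lF; elim: k => //= k IHk; exact: local_eps. Qed.

(** Each factor costs one collar: twisting along collar [k] turns agreement with [c] on [Z k.+1]
    into agreement on [Z k], and the collars are used from the outside in. *)
Let span_iter k L : (k <= m)%N -> span (PP (Z k) c) L ->
  span (PP (Z 0) c) (fun F => L (iteri k eps F)).
Proof.
elim: k L => [//|k IHk] L km sL.
pose L1 G := L G - \sum_(i < n | J i) u i * L (G \o twist k i).
apply: (@span_eq _ _ _ (fun F => L1 (iteri k eps F))) => [F|].
  rewrite /L1 /= /eps (span_subf _ _ sL) (span_sumf _ _ sL); congr (_ - _).
  by apply: eq_bigr => i _; rewrite (span_scalef _ _ sL).
apply: IHk; first exact: ltnW.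
apply: spanB.
  apply: span_sub sL => f [hf fc]; split => // x Zx; apply: fc.
  by apply: le_trans Zx _; rewrite ler_nat.
apply: span_sum => i Ji; apply: spanZ; apply: span_comp sL => f.
exact: twist_hom.
Qed.

(** By pigeonhole [T] misses some open collar [k]. On [T], twisting along it changes nothing, and
    since the coefficients add up to 1, the factor [eps k] vanishes on maps equal to [c] that
    far. *)
Let iter_vanish T F : (size T <= s.+1)%N -> local_on [set x | x \in T] F ->
  iteri m eps F c = 0.
Proof.
move=> sT lF.
have [k km kT] : exists2 k, (k < m)%N & forall x, x \in T ->
    m%:R * w x <= k%:R \/ k.+1%:R <= m%:R * w x.
  apply: contrapT => nk.
  have {nk} H (k : 'I_m) : exists x, x \in T /\ k%:R < m%:R * w x < k.+1%:R.
    apply: contrapT => nx; apply: nk; exists k => // x xT.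
    have [?|kx] := leP (m%:R * w x) k%:R; [by left|right].
    by rewrite leNgt; apply/negP => xk; apply: nx; exists x; rewrite kx xk.
  have [g gP] := choice H.
  have : uniq [seq g k | k <- enum 'I_m].
    rewrite map_inj_uniq ?enum_uniq// => k l gkl; apply/val_inj => /=.
    have [_ /andP[k1 k2]] := gP k; have [_ /andP[l1 l2]] := gP l.
    rewrite gkl in k1 k2; have kl : (k < l.+1)%N.
      by rewrite -(ltr_nat R); exact: lt_trans k1 l2.
    have lk : (l < k.+1)%N by rewrite -(ltr_nat R); exact: lt_trans l1 k2.
    by apply/eqP; rewrite eqn_leq; apply/andP; split.
  move=> uniq_g; have : (size [seq g k | k <- enum 'I_m] <= size T)%N.
    by apply: (uniq_leq_size uniq_g) => _ /mapP[k _ ->]; case: (gP k).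
  by rewrite size_map size_enum_ord leqNgt ltnS sT.
(* For the later factors to preserve the vanishing, it is claimed for all maps that agree with [c]
   up to collar [j], a class that contains both [f] and its twists. *)
suff H j : (k < j)%N -> (j <= m)%N -> forall f,
    (forall x, m%:R * w x < j%:R -> f x = c x) -> iteri j eps F f = 0.
  exact: H.
elim: j => // j IHj; rewrite ltnS leq_eqVlt => /orP[/eqP <-|kj] jm f fc /=; last first.
  rewrite /eps IHj//; last 2 first.
  - exact: ltnW.
  - by move=> x xj; apply: fc; apply: lt_le_trans xj _; rewrite ler_nat.
  rewrite big1 ?subrr// => i Ji; rewrite IHj ?mulr0//; first exact: ltnW.
  by move=> x /ltW; exact: twist_near.
rewrite /eps; have lG := @local_iter _ k _ lF.
rewrite (eq_bigr (fun i => u i * iteri k eps F f)); last first.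
  move=> i Ji; congr (_ * _); apply: lG => x /= xT.
  have [xk|xk] := kT x xT.
    rewrite twist_near// fc//; apply: le_lt_trans xk _.
    by rewrite ltr_nat.
  rewrite /twist /move_along /collar clamp_eq1 ?subrr ?eqxx//.
  by rewrite lerBrDr addrC natr1.
by rewrite -mulr_suml (agreeing_sum1 sK) mul1r subrr.
Qed.

(** Since [twist k i c] is [path_at i (collar k)], the ensemble [B k] evaluates a function [G] local
    on the test points to [G c - eps k G c]. Summing over the iterates telescopes to [F c] minus a
    term killed by [iter_vanish]. *)
Lemma deformable_rel_step :
  exists2 L, span (PP [set x | w x <= 0] c) L & represents s.+1 L c.
Proof.
have [B BP] : {B : 'I_m -> ((X -> Y) -> int) -> int & forall k : 'I_m,
    span (PP (Z k) c) (B k) /\ forall T F, (size T <= s.+1)%N ->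
    local_on [set x | x \in T] F ->
    B k F = \sum_(i < n | J i) u i * F (path_at i (collar k))}.
  apply: (@choice _ _ (fun (k : 'I_m) Bk => span (PP (Z k) c) Bk /\ forall T F,
    (size T <= s.+1)%N -> local_on [set x | x \in T] F ->
    Bk F = \sum_(i < n | J i) u i * F (path_at i (collar k)))) => k.
  by have [L sL HL] := span_collar (ltn_ord k); exists L.
exists (fun F => \sum_(k < m) B k (iteri k eps F)).
  apply: (@span_sub _ _ (PP (Z 0) c)).
    move=> f [hf fc]; split => // x /= wx; apply: fc.
    by rewrite /Z /= pmulr_rle0.
  by apply: span_sum => k _; apply: span_iter; [exact: ltnW|case: (BP k)].
move=> T F sT lF.
have BE (k : 'I_m) : B k (iteri k eps F) = iteri k eps F c - iteri k.+1 eps F c.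
  have [_ /(_ _ _ sT (@local_iter _ k _ lF)) ->] := BP k.
  rewrite /= {2}/eps subKr; apply: eq_bigr => i Ji.
  by rewrite twist_c.
rewrite (eq_bigr _ (fun k _ => BE k)) -(big_mkord xpredT
  (fun k => iteri k eps F c - iteri k.+1 eps F c)).
rewrite (eq_bigr (fun k => - (iteri k.+1 eps F c - iteri k eps F c))); last first.
  by move=> k _; exact/esym/opprB.
rewrite sumrN telescope_sumr// (iter_vanish sT lF) sub0r opprK.
by [].
Qed.

End induction_step.

(** After [agreeing_start] the maps [op (a i)] equal [c] on [w <= 1], so that any homotopies from
    them to [c] serve as [h i]. *)
Lemma deformable_relP s : deformable_rel s.
Proof.
elim: s => [|s IH]; first exact: deformable_rel0.
move=> K w c sK cw wU hc.
have [op [opx opc hopb hopa]] := agreeing_start sK cw wU hc.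
pose J i := `[< forall x, U K x -> a i x = b x >].
have [h hP] : {h : 'I_n -> R * X -> Y & forall i, J i ->
    [/\ continuous (h i), forall x, h i (0, x) = op (a i) x,
        forall x, h i (1, x) = c x & forall t, h i (t, point) = point]}.
  apply: (@choice _ _ (fun i (hi : R * X -> Y) => J i ->
    [/\ continuous hi, forall x, hi (0, x) = op (a i) x,
        forall x, hi (1, x) = c x & forall t, hi (t, point) = point])) => i.
  have [/asboolP Ji|nJi] := pselect (J i); last by exists (fun=> point).
  have /homP[hi hiP] : hom R (op (a i)) c.
    by apply: hom_trans hc; apply: hom_sym; exact: hopa.
  by exists hi.
have h0 i : J i -> (fun x => h i (0, x)) = op (a i).
  by move=> Ji; apply/funext => x; case: (hP i Ji).
apply: (deformable_rel_step IH sK cw wU (b' := op b) (h := h)) => //.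
- by move=> x; exact: opc.
- by move=> i Ji; case: (hP i Ji).
- by move=> i t Ji; case: (hP i Ji).
- by move=> i Ji; rewrite h0//; apply: hopa; exact/asboolP.
- by move=> i x Ji wx; case: (hP i Ji) => _ -> _ _; exact: opc.
- by move=> i x Ji; case: (hP i Ji).
move=> T F sT lF; rewrite (eq_bigr (fun i => u i * (F \o op) (a i))); last first.
  by move=> i Ji; rewrite /= h0.
apply: (agreeing_sum sK sT) => f g fg; apply: lF => x xT.
by apply: opx; exact: fg.
Qed.

Lemma deformable : based_cont a0 ->
  exists2 L, span (hom R b) L & represents r L a0.
Proof.
(* With no prescribed points and [w] constantly 2, the condition on [U K] is vacuous and nothing is
   prescribed. *)
move=> ca0; have c2 : continuous ((fun=> 2) : X -> R).
  by apply/cont_inT; exact: cont_in_cst.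
have [|L sL rL] := @deformable_relP r [::] (fun=> 2) a0 (leqnn _) c2 _ (hom_refl R ca0).
  by move=> x; rewrite ltxx.
by exists L => //; apply: span_sub sL => f [].
Qed.

End symmetry.

(** * Pointwise deformations of ensembles *)

Section similarity.
Variables (R : realType) (X Y : ptopologicalType).
Hypotheses (hX : hausdorff_space X) (cX : compact [set: X]) (cellY : cellular R Y).

Let hY : hausdorff_space Y.
Proof. by case: cellY => K _; exact: cw_hausdorff K. Qed.

Lemma merging_images n (f : 'I_n -> X -> Y) : (forall i, continuous (f i)) ->
  exists S : set Y, merging R S /\ forall i x, S (f i x).
Proof.
move=> cf; have [K [e [e0 ep]]] := cellY.
pose A := \big[setU/set0]_(i < n) range (f i).
have cA : compact A.
  apply: bigsetU_compact => i _; apply: continuous_compact => //.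
  exact: continuous_subspaceT.
have [S [[_ _ mS _] _ AS]] := subcomplex_compact cA (subcomplex_point e0 ep).
exists S; split => // i x; apply: AS.
by rewrite /A (bigD1 i)//=; left; exists x.
Qed.

Lemma merge_along (S : set Y) (Psi : Y * Y -> Y) (b f : X -> Y) :
  hom_in R (S `*` S) (point, point) point snd Psi ->
  based_cont b -> based_cont f -> (forall x, S (b x)) -> (forall x, S (f x)) ->
  hom R f (fun x => Psi (b x, f x)).
Proof.
move=> [H [cH H0 H1 Hp]] [cb bp] [cf fp] Sb Sf.
exists (fun tx => H (tx.1, (b tx.2, f tx.2))); split.
- apply: (cont_in_comp (f := fun tx : R * X => (tx.1, (b tx.2, f tx.2))) cH).
    apply: cont_in_pair; first by apply: cont_in_fst; exact: cont_in_id.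
    have c2 : cont_in (setT `*` [set: X]) (fun tx : R * X => tx.2).
      by apply: cont_in_snd; exact: cont_in_id.
    by apply: cont_in_pair; apply: (cont_in_comp (D := setT)) c2 _ => //; exact/cont_inT.
  by move=> tx _; split => //=; split.
- by move=> x _; rewrite H0 //; split; [exact: Sb|exact: Sf].
- by move=> x _; rewrite H1 //; split; [exact: Sb|exact: Sf].
- by move=> t /=; rewrite bp fp.
Qed.

(** The operation [Phi] acts pointwise, so it preserves the representation. It first merges with
    [b]; where [v] is nonzero the merged map is that of [b] itself and can follow a homotopy [q] to
    [b']. As [v] is 1 on the diagonal, [b] is sent exactly to [b']. *)
Lemma represents_hom r n (u : 'I_n -> int) (a : 'I_n -> X -> Y) (a0 b b' : X -> Y) :
  (forall i, hom R a0 (a i)) ->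
  represents r (fun F => \sum_(i < n) u i * F (a i)) b -> hom R b b' ->
  exists2 L, span (hom R a0) L & represents r L b'.
Proof.
move=> ha rb hbb'.
have bcb := hom_based_contl hbb'.
have bca i := hom_based_cont (ha i).
pose f (i : 'I_n.+1) := if unlift ord0 i is Some j then a j else b.
have cf i : continuous (f i).
  by rewrite /f; case: unliftP => [j _|_]; [exact: (bca j).1|exact: bcb.1].
have [S [[Psi [v [hPsi cv v1 vPsi]]] Sf]] := merging_images cf.
have Sa i x : S (a i x) by have := Sf (fintype.lift ord0 i) x; rewrite /f liftK.
have Sb x : S (b x) by have := Sf ord0 x; rewrite /f unlift_none.
have hb1 := merge_along hPsi bcb bcb Sb Sb.
have /homP[q [cq q0 q1 qp]] := hom_trans (hom_sym hb1) hbb'.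
pose Phi x y := if v (b x, y) == 0 then Psi (b x, y) else q (v (b x, y), x).
exists (fun F => \sum_(i < n) u i * F (fun x => Phi x (a i x))).
  apply: span_sum => i _; apply: spanZ; apply: span_pt.
  apply: hom_trans (ha i) _; have h1 := merge_along hPsi bcb (bca i) Sb (Sa i).
  apply: (hom_trans h1).
  rewrite -[X in hom _ _ X]/(move_along q (fun x => v (b x, a i x))
    (fun x => Psi (b x, a i x))).
  apply: move_along_hom => //; first exact: hom_based_cont h1.
    apply/cont_inT; apply: (cont_in_comp (f := fun x => (b x, a i x)) cv) => //.
      by apply: cont_in_pair; apply/cont_inT; [exact: bcb.1|exact: (bca i).1].
    by move=> x _; split; [exact: Sb|exact: Sa].
  by move=> x vx; rewrite q0 vPsi.
move=> T F sT lF.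
rewrite (rb T (fun f => F (fun x => Phi x (f x)))) //; last first.
  by move=> g g' gg'; apply: lF => x xT; rewrite gg'.
congr F; apply/funext => x; rewrite /Phi v1// oner_eq0.
by rewrite q1.
Qed.

(** For each [j] in turn, all maps are merged with the current [f' j]. Where a map meets it, [v] is
    1, hence nonzero nearby, and there the merged maps coincide. Earlier coincidences survive
    because the operation is pointwise. *)
Lemma thicken_equalities n (f : 'I_n -> X -> Y) (js : seq 'I_n) :
  (forall i, based_cont (f i)) ->
  exists f' : 'I_n -> X -> Y, [/\ forall i, hom R (f i) (f' i),
    forall i j x, f i x = f j x -> f' i x = f' j x &
    forall i j x, j \in js -> f i x = f j x ->
      \forall y \near x, f' i y = f' j y].
Proof.
move=> bcf; elim: js => [|j js [f' [hf' f'eq f'js]]].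
  by exists f; split => // i; exact: hom_refl.
have bcf' i := hom_based_cont (hf' i).
have [S [[Psi [v [hPsi cv v1 vPsi]]] Sf]] := merging_images (fun i => (bcf' i).1).
exists (fun i x => Psi (f' j x, f' i x)); split.
- move=> i; apply: hom_trans (hf' i) _.
  exact: (merge_along hPsi (bcf' j) (bcf' i) (Sf j) (Sf i)).
- by move=> i k x /f'eq ->.
move=> i k x; rewrite inE => /orP[/eqP ->|kjs] fik; last first.
  by apply: filterS (f'js _ _ _ kjs fik) => y ->.
have cvi : continuous (fun x => v (f' j x, f' i x)).
  apply/cont_inT; apply: (cont_in_comp (f := fun x => (f' j x, f' i x)) cv) => //.
    by apply: cont_in_pair; apply/cont_inT; exact: (bcf' _).1.
  by move=> y _; split; exact: Sf.
have : \forall y \near x, v (f' j y, f' i y) != 0.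
  have : nbhs (v (f' j x, f' i x)) [set t | t != 0].
    apply: open_nbhs_nbhs; split; first exact: open_neq.
    by rewrite /= (f'eq _ _ _ fik) v1// oner_eq0.
  exact: cvi.
by apply: filterS => y vy; apply: vPsi.
Qed.

Lemma represents_sym r n (u : 'I_n -> int) (a : 'I_n -> X -> Y) (a0 b : X -> Y) :
  based_cont a0 -> based_cont b -> (forall i, hom R a0 (a i)) ->
  represents r (fun F => \sum_(i < n) u i * F (a i)) b ->
  exists2 L, span (hom R b) L & represents r L a0.
Proof.
move=> bca0 bcb ha rb.
pose f (i : 'I_n.+1) := if unlift ord0 i is Some j then a j else b.
have fa i : f (fintype.lift ord0 i) = a i by rewrite /f liftK.
have fb : f ord0 = b by rewrite /f unlift_none.
have [|f' [hf' f'eq f'near]] := @thicken_equalities _ f (enum 'I_n.+1).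
  by move=> i; rewrite /f; case: unliftP => // j _; exact: hom_based_cont (ha j).
(* On [N x] every coincidence at [x] between the original maps holds between the thickened ones;
   finitely many conditions make it a neighbourhood. *)
pose W x := [set y | forall i j, f i x = f j x -> f' i y = f' j y].
pose N x := interior (W x).
have Nx x : N x x.
  apply: filter_forall => i; apply: filter_forall => j.
  have [fij|nfij] := pselect (f i x = f j x); last by apply: nearW.
  have : \forall y \near x, f' i y = f' j y by apply: f'near => //; rewrite mem_enum.
  by apply: filterS.
have hbb' : hom R b (f' ord0) by rewrite -fb.
have [||||L sL rL] := @deformable R X Y hX cX hY n u (fun i => f' (fintype.lift ord0 i))
    (f' ord0) a0 r N _ _ _ Nx _ bca0; last first.
- by exists L => //; apply: span_sub sL => g; exact: hom_trans.
- move=> K F sK lF.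
  (* This transports [F] to a function of the original maps local on [K]. The choice of [i] is
     harmless: maps [f i] equal on [K] have thickenings equal on [U K]. The value 0 is never met on
     the maps in question. *)
  pose G (g : X -> Y) : int :=
    if [pick i | `[< forall x, x \in K -> g x = f i x >]] is Some i
    then F (f' i) else 0.
  have GE i : G (f i) = F (f' i).
    rewrite /G; case: pickP => [j /asboolP ij|/(_ i)/asboolP[]//].
    apply: lF => y [x xK Nxy].
    by apply: (interior_subset Nxy); rewrite ij.
  have := rb K G sK; rewrite -fb GE => <-.
    by apply: eq_bigr => i _; rewrite -fa GE.
  move=> g g' gg'; rewrite /G.
  rewrite (eq_pick (Q := fun i => `[< forall x, x \in K -> g' x = f i x >]))//.
  move=> i; apply: asbool_equiv_eq; split=> H x xK; rewrite -H//.
    by rewrite gg'.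
  by rewrite -gg'.
- by move=> x; exact: open_interior.
- exact: hom_based_cont hbb'.
- by move=> i; apply: hom_trans (ha i) _; rewrite -fa.
Qed.

End similarity.

(** * Restriction of ensembles *)

Section based_maps.
Variables (R : realType) (X Y : ptopologicalType).
Implicit Types (a b c : basedMap X Y).

Lemma basedMap_eq a b : (forall x, a x = b x) -> a = b.
Proof.
move=> /funext ab; case: a b ab => [f [[fp] [fc]]] [g [[gp] [gc]]] /= fg.
move: fp fc; rewrite fg => fp fc.
by rewrite (Prop_irrelevance fp gp) (Prop_irrelevance fc gc).
Qed.

Lemma basedMap_cont a : based_cont a.
Proof. by split; [exact: cts_fun|exact: based_point]. Qed.

Lemma based_cont_map (f : X -> Y) : based_cont f -> exists a, a = f :> (X -> Y).
Proof.
move=> [cf fp].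
pose m1 := isBased.Build X Y f fp.
pose m2 := isContinuous.Build X Y f cf.
pose a : basedMap X Y := HB.pack f m1 m2.
by exists a.
Qed.

Lemma homotopicP a b : homotopic R a b <-> hom R a b.
Proof.
split=> [[H [cH H0 H1 Hp]]|/homP[H [cH H0 H1 Hp]]]; last first.
  exists H; split => //; exact: continuous_subspaceT.
have clampI (t : R) : `[0, 1]%classic (clamp t).
  by rewrite /= in_itv/= clamp_ge0 clamp_le1.
exists (fun tx => H (clamp tx.1, tx.2)); split.
- apply: (cont_in_comp (g := H) (f := fun tx : R * X => (clamp tx.1 : R, tx.2))
    (D := (`[0, 1]%classic : set R) `*` [set: X])).
  + exact/cont_inP.
  + apply: cont_in_pair; last by apply: cont_in_snd; exact: cont_in_id.
    by apply: cont_in_clamp; apply: cont_in_fst; exact: cont_in_id.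
  + by move=> [t x] _; split => //; exact: clampI.
- by move=> x _ /=; rewrite clamp_eq0.
- by move=> x _ /=; rewrite clamp_eq1.
- by move=> t /=; rewrite Hp//; exact: clampI.
Qed.

End based_maps.

Section freeg_lift.
Variables (K : choiceType) (M : lmodType int) (f : K -> M).

Lemma fglift_sum n (u : 'I_n -> int) (c : 'I_n -> K) :
  fglift f (\sum_(i < n) << u i *g c i >>) = \sum_(i < n) u i *: f (c i).
Proof.
have fB := lift_is_additive f.
have f0 : fglift f 0 = 0 by rewrite -(subrr 0) fB subrr.
have fD : {morph fglift f : x y / x + y}.
  by move=> x y; rewrite -[y in LHS]opprK fB -[- y]add0r fB f0 sub0r opprK.
by rewrite (big_morph _ fD f0); apply: eq_bigr => i _; rewrite liftU.
Qed.

End freeg_lift.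

Section restriction.
Variables (X Y : ptopologicalType).

Lemma freeg_scale (K : choiceType) (k : int) (x : K) :
  k *: << x >> = << k *g x >> :> {freeg K}.
Proof. by apply/eqP/freeg_eqP => y; rewrite coeffZ !coeffU mul1r. Qed.

Lemma restrict_sum (T : basedSubset X) n (u : 'I_n -> int) (c : 'I_n -> basedMap X Y) :
  Defs.restrict T (\sum_(i < n) << u i *g c i >>) =
  \sum_(i < n) << u i *g restrict_map T (c i) >>.
Proof.
by rewrite /Defs.restrict fglift_sum; apply: eq_bigr => i _; rewrite freeg_scale.
Qed.

Lemma restrict_pt (T : basedSubset X) (b : basedMap X Y) :
  Defs.restrict T << b >> = << restrict_map T b >>.
Proof. by rewrite /Defs.restrict liftU scale1r. Qed.

(** From left to right, a test function on maps of [X] becomes one on the restricted maps through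
    extension by the basepoint. Conversely, the coefficient of a restricted map [g] is the value of
    an indicator function. *)
Lemma r_equalP r n (u : 'I_n -> int) (c : 'I_n -> basedMap X Y) (b : basedMap X Y) :
  r_equal r (\sum_(i < n) << u i *g c i >>) << b >> <->
  represents r (fun F => \sum_(i < n) u i * F (c i)) b.
Proof.
split=> [H T F sT lF|H Z ZT].
  pose Z := BasedSubset (or_introl erefl : [set x | x = point \/ x \in T] point).
  have FZ : Fr r Z.
    have XT : Z `\ point `<=` [set` T] by move=> x [/= [->//|xT] _].
    apply: card_le_trans (subset_card_le XT) _.
    have TI : [set` T] `<=` nth point T @` `I_(size T).
      by move=> x /= xT; exists (index x T); rewrite /= ?index_mem// nth_index.
    apply: card_le_trans (subset_card_le TI) _.
    apply: card_le_trans (card_image_le _ _) _.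
    by rewrite card_le_II.
  (* The extension need not be continuous; being local, [F] ignores the values off [Z]. *)
  pose ext (g : basedMap (basedSub Z) Y) (x : X) : Y :=
    if pselect (based_set Z x) is left Zx then g (exist _ x (mem_set Zx)) else point.
  have extE (a : basedMap X Y) : F (ext (restrict_map Z a)) = F a.
    apply: lF => x xT; rewrite /ext; case: pselect => // -[].
    by right.
  have := H Z FZ; rewrite restrict_sum restrict_pt.
  move=> /(congr1 (fglift (fun g => F (ext g) : int^o))).
  rewrite fglift_sum liftU scale1r extE => <-.
  by apply: eq_bigr => i _; rewrite extE.
have finZ : finite_set (Z `\ point) by exact: card_le_finite ZT (finite_II r).
pose T : seq X := finmap.enum_fset (fset_set (Z `\ point)).
have TP x : (x \in T) = (x \in Z `\ point) by rewrite -(in_fset_set finZ).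
have sT : (size T <= r)%N.
  have [m Zm] := finZ; have := card_fset_set Zm; rewrite /T => ->.
  by rewrite -(@card_le_II m r) -(card_le_eql Zm).
rewrite restrict_sum restrict_pt; apply/eqP/freeg_eqP => g.
rewrite raddf_sum /= coeffU mul1r.
(* Only points other than the basepoint are compared, since [T] omits it; based maps agree there
   anyway. *)
pose F (f : X -> Y) : int := (`[< forall z : basedSub Z, Defs.incl z <> point ->
  f (Defs.incl z) = g z >])%:R.
have FE (a : basedMap X Y) : (restrict_map Z a == g)%:R = F a.
  rewrite /F; congr (nat_of_bool _)%:R; apply/eqP/asboolP => [<- //|ag].
  apply: basedMap_eq => z; have [zp|/ag //] := pselect (Defs.incl z = point).
  have -> : z = point by apply/val_inj.
  by rewrite !based_point.
rewrite FE -(H T F sT).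
  by apply: eq_bigr => i _; rewrite coeffU FE.
move=> f f' ff'; rewrite /F; congr (nat_of_bool _)%:R.
apply: asbool_equiv_eq; split=> fz z zp; rewrite -fz//.
  by rewrite ff'//= TP; apply/mem_set; split => //; exact: set_valP.
by rewrite -ff'//= TP; apply/mem_set; split => //; exact: set_valP.
Qed.

End restriction.

(** * The equivalence relation *)

Lemma r_similarP (R : realType) (r : nat) (X Y : ptopologicalType)
    (a b : basedMap X Y) :
  r_similar R r a b <-> exists2 L, span (hom R a) L & represents r L b.
Proof.
split=> [[n [u [c [hc /r_equalP H]]]]|[L /span_family[n [u [f [hf LE]]]] H]].
  exists (fun F => \sum_(i < n) u i * F (c i)) => //.
  apply: span_sum => i _; apply: spanZ; apply: span_pt.
  by apply: hom_sym; apply/homotopicP.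
have /choice[c cf] : forall i, exists c : basedMap X Y, c = f i :> (X -> Y).
  by move=> i; apply: based_cont_map; exact: hom_based_cont (hf i).
exists n, u, c; split.
  by move=> i; apply/homotopicP; rewrite cf; exact: hom_sym.
apply/r_equalP => T F sT lF; rewrite -(H T F sT lF) LE.
by apply: eq_bigr => i _; rewrite cf.
Qed.

Theorem theorem8p1 (R : realType) (X Y : ptopologicalType) (r : nat)
    (cellX : cellular R X) (cellY : cellular R Y)
    (compactX : compact [set: X]) :
  RelationClasses.Equivalence (@r_similar R r X Y).
Proof.
have hX : hausdorff_space X by case: cellX => K _; exact: cw_hausdorff K.
split.
- move=> a; apply/r_similarP; exists (fun F => F a).
    by apply: span_pt; apply: hom_refl; exact: basedMap_cont.
  by move=> T F.
- move=> a b /r_similarP[L /span_family[n [u [f [hf LE]]]] H].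
  apply/r_similarP; apply: (represents_sym hX compactX cellY (u := u) _ _ hf).
  + exact: basedMap_cont.
  + exact: basedMap_cont.
  + by move=> T F sT lF /=; rewrite -LE; exact: (H T).
- move=> a b c /r_similarP[L /span_family[n [u [f [hf LE]]]] H].
  move=> /r_similarP[L' /span_family[m [v [g [hg LE']]]] H'].
  (* Each map [g j] is homotopic to [b], so it is itself represented by maps homotopic to [a]; these
     ensembles are substituted into the one for [c]. *)
  have [M MP] : {M : 'I_m -> ((X -> Y) -> int) -> int & forall j,
      span (hom R a) (M j) /\ represents r (M j) (g j)}.
    apply: (@choice _ _ (fun j Mj => span (hom R a) Mj /\ represents r Mj (g j))) => j.
    have [|Mj] := represents_hom compactX cellY (r := r) (u := u) hf _ (hg j).
      by move=> T F sT lF /=; rewrite -LE; exact: (H T).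
    by exists Mj.
  apply/r_similarP; exists (fun F => \sum_(j < m) v j * M j F).
    by apply: span_sum => j _; apply: spanZ; case: (MP j).
  move=> T F sT lF; rewrite -(H' T F sT lF) LE'.
  by apply: eq_bigr => j _; have [_ /(_ T F sT lF) ->] := MP j.
Qed.
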